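(* Let $n\ge 1$ be an integer and let $\mathbf{B}^n=\{x\in\mathbf{R}^n:\|x\|\le 1\}$ be the closed unit ball. Let $\gamma\colon[0,\infty)\to\mathbf{R}^n$ be any path (in the sense defined in the context), and let $\ell\colon[0,\infty)\to\mathbf{R}^n$ be a straight line path, $\ell(s)=su$ for a fixed unit vector $u\in\mathbf{R}^n$. Let $X$ be a random variable uniformly distributed in $\mathbf{B}^n$. Then \[ J(\gamma)\ge J(\ell), \] where for a path $\eta$ we set $J(\eta)=\mathbb{E}[T_\eta(X)]$ and $T_\eta(x)=\inf\{t\ge 0: x+\eta(t)\notin\operatorname{int}(\mathbf{B}^n)\}$ (with $\inf\emptyset=\infty$).
   Context: $\|\cdot\|$ is the Euclidean norm. A path is a continuous curve $\gamma\colon[0,\infty)\to\mathbf{R}^n$ with $\gamma(0)=0$ that is arc-length parametrised: for every $t>0$, the length of the curve from $\gamma(0)$ to $\gamma(t)$ is exactly $t$ (corners are allowed). The escape time $T_\gamma(x)$ from a starting point $x\in\mathbf{B}^n$ is the first time $t\ge0$ at which $x+\gamma(t)$ leaves the interior of the unit ball, defined to be $\infty$ if this never happens. The expected escape time is $J(\gamma)=\mathbb{E}[T_\gamma(X)]$ with $X$ uniform in $\mathbf{B}^n$. *)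

(* Defs.v *)
From HB Require Import structures.
From mathcomp Require Import all_boot all_order all_algebra.
From mathcomp Require Import all_classical all_reals all_analysis.
Set Implicit Arguments. Unset Strict Implicit. Unset Printing Implicit Defensive.
Import Order.TTheory GRing.Theory Num.Theory.
Import numFieldTopology.Exports numFieldNormedType.Exports.
Local Open Scope classical_set_scope.
Local Open Scope ring_scope.

Section Defs.
Variable R : realType.

(* Euclidean norm on R^n (the library norm on 'rV is the max norm). *)
Definition euclid (n : nat) (x : 'rV[R]_n) : R :=
  Num.sqrt (\sum_(i < n) x ord0 i ^+ 2).

Definition curve_length (n : nat) (gamma : R -> 'rV[R]_n) (a b : R) : \bar R :=
  ereal_sup [set l : \bar R | exists (k : nat) (s : nat -> R),
     [/\ s 0%N = a, s k = b, (forall i, (i < k)%N -> s i <= s i.+1) &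
         l = (\sum_(i < k) euclid (gamma (s i.+1) - gamma (s i)))%:E]].

Definition is_path (n : nat) (gamma : R -> 'rV[R]_n) : Prop :=
  [/\ {within [set t : R | 0 <= t], continuous gamma},
      gamma 0 = 0 &
      forall t : R, 0 < t -> curve_length gamma 0 t = t%:E].

Definition escape_time (n : nat) (gamma : R -> 'rV[R]_n) (x : 'rV[R]_n) : \bar R :=
  ereal_inf [set t%:E | t in [set t : R | 0 <= t /\ 1 <= euclid (x + gamma t)]].

(* Lebesgue integral on R^n of a nonnegative function, written as the iterated
   integral over the coordinates (equal to the integral for the n-dimensional
   Lebesgue measure by Tonelli for nonnegative Borel functions). *)
Fixpoint iter_int (m : nat) (f : (nat -> R) -> \bar R) (x : nat -> R) : \bar R :=
  match m with
  | 0%N => f x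
  | m'.+1 => (\int[@lebesgue_measure R]_(t in [set: R])
                 iter_int m' f (fun j => if j == m' then t else x j))%E
  end.

Definition leb_int (n : nat) (F : 'rV[R]_n -> \bar R) : \bar R :=
  iter_int n (fun x => F (\row_(i < n) x (nat_of_ord i))) (fun _ => 0).

Definition closed_ball_ind (n : nat) (x : 'rV[R]_n) : \bar R :=
  if euclid x <= 1 then 1%E else 0%E.

Definition ball_volume (n : nat) : \bar R := leb_int (@closed_ball_ind n).

Definition expected_escape (n : nat) (gamma : R -> 'rV[R]_n) : \bar R :=
  (leb_int (fun x => if (euclid x <= 1)%R then escape_time gamma x else 0%E)
   * ((fine (ball_volume n))^-1)%:E)%E.

End Defs.

(* Main.v *)
(** A path is 1-Lipschitz.  Cut [[0, t]] into [N = 2 ^ m] equal pieces and let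
    [w_j / N] be the increments of the path, so that [|w_j| <= t].  If every [x_j]
    is in the lens of the [x] with [|x| < r] and [|x + w_j| < r], then by convexity
    the mean of the [x_j] stays at norm [< r] at all the division points of the
    path, hence in the unit ball up to time [t] when [r = 1 - t / N].  By the
    Brunn-Minkowski inequality (from Prekopa-Leindler at midpoints, iterated [m]
    times) the set of the starting points that survive up to [t] has at least the
    volume of the smallest of these lenses, which depends only on [|w_j| <= t], and
    is at least that of the lens of direction [t u].  Letting [r] tend to 1, this
    last lens is the set of the points that survive up to [t] along the line;
    summing over [t] compares the expectations. *)
Require Import Defs.
From HB Require Import structures.
From mathcomp Require Import all_boot all_order all_algebra.
From mathcomp Require Import all_classical all_reals all_analysis.
From mathcomp Require Import measurable_realfun ring lra.
Import Order.TTheory GRing.Theory Num.Theory.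
Import numFieldTopology.Exports numFieldNormedType.Exports.
Local Open Scope classical_set_scope.
Local Open Scope ring_scope.

(** Measurability shapes the proof. The set of starting points that survive along [gamma], and the
    midpoint sets met on the way to it, are never shown measurable, and the lower integral of an
    arbitrary function is only monotone and superadditive. Both properties are on the right side for
    [gamma], which is always on the larger side of an inequality; exact additivity, Tonelli and
    monotone convergence are used on lenses, which are explicitly measurable.

    The induction on the dimension runs on Prekopa-Leindler because its hypothesis
    [f x * g y <= h z * h z], with [z] the midpoint, reproduces itself when one coordinate is
    integrated out. That lens volumes depend only on the norm of the direction is obtained from
    plane rotations written as products of shears: on each coordinate line a shear is a translation,
    the one change of variables that an iterated integral needs here.

    The passage to expectations compares an upper level sum for the line with a lower one for
    [gamma]; they differ by a single term. *)

(** * Lower integrals of arbitrary nonnegative functions *)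

Section Integral.
Local Open Scope ereal_scope.
Context d (T : measurableType d) (R : realType).
Variable mu : {measure set T -> \bar R}.
Implicit Types f g h : T -> \bar R.
Import HBNNSimple.

(* [integral] is defined as a lower integral, so that monotonicity needs no
   measurability. *)
Lemma ge0_le_lower_integral f g : (forall x, 0 <= f x) ->
  (forall x, f x <= g x) -> \int[mu]_x f x <= \int[mu]_x g x.
Proof.
move=> f0 fg; rewrite !ge0_integralTE//; last by move=> x; exact: le_trans (fg x).
apply: ereal_sup_le => _ [h hf <-]; exists h => // x.
exact: le_trans (fg x).
Qed.

(** The supremum of a sequence of simple functions below [f] whose integrals tend to the supremum
    defining the lower integral. It reduces claims about arbitrary functions to measurable ones. *)
Lemma measurable_lower_envelope f : (forall x, 0 <= f x) ->
  exists g, [/\ measurable_fun [set: T] g, forall x, 0 <= g x,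
    forall x, g x <= f x & \int[mu]_x g x = \int[mu]_x f x].
Proof.
move=> f0; pose S := [set sintegral mu h | h in
  [set h : {nnsfun T >-> R} | forall x, (h x)%:E <= f x]].
have S0 : S != set0.
  apply/set0P; exists (sintegral mu (cst_nnsfun T (NngNum (@lexx _ R 0%R)))).
  by exists (cst_nnsfun T (NngNum (@lexx _ R 0%R))).
have [u_ uS ucvg] := ereal_sup_seq S0.
have /choice[h hP] : forall n, exists h : {nnsfun T >-> R},
    (forall x, (h x)%:E <= f x) /\ sintegral mu h = u_ n.
  by move=> n; have [h hf hu] := uS n; exists h.
pose g x := esups (fun n => (h n x)%:E) 0%N.
have gle n x : (h n x)%:E <= g x by apply: ereal_sup_ubound; exists n.
have g0 x : 0 <= g x by apply: le_trans (gle 0%N x); rewrite lee_fin.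
have gf x : g x <= f x.
  by apply: ge_ereal_sup => _ [n _ <-]; exact: (hP n).1.
exists g; split => //.
  apply: measurable_fun_esups => n; exact/measurable_EFinP.
apply/eqP; rewrite eq_le ge0_le_lower_integral//=.
rewrite [leLHS]ge0_integralTE//.
have <- : limn u_ = ereal_sup S by exact/cvg_lim.
apply: lime_le; first by apply/cvg_ex; eexists; exact: ucvg.
apply: nearW => n; rewrite -(hP n).2 -integralT_nnsfun.
by apply: ge0_le_lower_integral => x; [rewrite lee_fin|exact: gle].
Qed.

Lemma lower_integralD f g : (forall x, 0 <= f x) -> (forall x, 0 <= g x) ->
  \int[mu]_x f x + \int[mu]_x g x <= \int[mu]_x (f x + g x).
Proof.
move=> /measurable_lower_envelope[f' [mf f0 ff <-]].
move=> /measurable_lower_envelope[g' [mg g0 gg <-]].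
rewrite -ge0_integralD//; apply: ge0_le_lower_integral => x.
  exact: adde_ge0.
exact: leeD.
Qed.

Lemma lower_integralZ (k : R) f : (0 <= k)%R -> (forall x, 0 <= f x) ->
  k%:E * \int[mu]_x f x <= \int[mu]_x (k%:E * f x).
Proof.
move=> k0 /measurable_lower_envelope[f' [mf f0 ff <-]].
rewrite -ge0_integralZl_EFin//; apply: ge0_le_lower_integral => x.
  by rewrite mule_ge0// lee_fin.
by rewrite lee_wpmul2l// lee_fin.
Qed.

End Integral.

(** * Lebesgue measure and affine maps of the line *)

Section Affine.
Context (R : realType).
Notation mu := (@lebesgue_measure R).

Lemma measurable_affine (c b : R) :
  measurable_fun setT (fun x : measurableTypeR R => c * x + b : measurableTypeR R).
Proof.
apply: measurable_funD; last exact: measurable_cst.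
by apply: measurable_funM; [exact: measurable_cst|exact: measurable_id].
Qed.

(** The pushforward scaled by [c] agrees with Lebesgue measure on half-open intervals, so uniqueness
    applies. *)
Lemma lebesgue_measure_affine (c b : R) (A : set R) : 0 < c ->
  measurable (A : set (measurableTypeR R)) ->
  (mu A = c%:E * mu [set x | A (c * x + b)%R])%E.
Proof.
move=> c0 mA.
pose phi : measurableTypeR R -> measurableTypeR R := fun x => c * x + b.
have mphi : measurable_fun setT phi by exact: measurable_affine.
pose nu := mscale (NngNum (ltW c0)) (pushforward mu phi).
have : mu A = nu mphi A.
  apply: lebesgue_measure_unique => // _ [[x y] _ <-].
  rewrite /nu /= /mscale /= /pushforward.
  have -> : phi @^-1` `]x, y]%classic = `](x - b) / c, (y - b) / c]%classic.
    apply/seteqP; split => z /=; rewrite !in_itv /= /phi.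
      by rewrite ltr_pdivrMr// ler_pdivlMr// ltrBlDr lerBrDr mulrC.
    by rewrite ltr_pdivrMr// ler_pdivlMr// ltrBlDr lerBrDr mulrC.
  rewrite !lebesgue_measure_itv/= !lte_fin ltr_pM2r ?invr_gt0// ltrD2r.
  case: ifPn => xy; last by rewrite mule0.
  rewrite -!EFinB -EFinM; congr EFin.
  by field; exact: lt0r_neq0.
by [].
Qed.

Lemma ge0_integral_translation (b : R) (f : R -> \bar R) :
  measurable_fun setT f -> (forall x, 0 <= f x)%E ->
  (\int[mu]_x f (x + b)%R = \int[mu]_x f x)%E.
Proof.
move=> mf f0.
pose phi : measurableTypeR R -> measurableTypeR R := fun x => 1 * x + b.
have mphi : measurable_fun setT phi by exact: measurable_affine.
transitivity (\int[mu]_(x in phi @^-1` setT) (f \o phi) x)%E.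
  by apply: eq_integral => x _; rewrite /= /phi mul1r.
rewrite -ge0_integral_pushforward//.
apply: eq_measure_integral => A mA _.
by rewrite /pushforward [RHS](lebesgue_measure_affine 1 b)// mul1e.
Qed.

End Affine.

(** * Discrete layer-cake bounds *)

Section LevelSums.
Context (R : realType).
Implicit Types (v delta : R) (N : nat).

(** The bound on [v] does not survive induction on [N]; truncating [v] at [delta * N] gives a
    statement that does. *)
Lemma le_level_sum v delta N : 0 <= delta -> v <= delta * N%:R ->
  v <= delta * \sum_(k < N) (delta * k%:R < v)%R%:R.
Proof.
move=> d0 vN; suff : Num.min v (delta * N%:R) <=
    delta * \sum_(k < N) (delta * k%:R < v)%R%:R by rewrite min_l.
elim: N {vN} => [|N IH]; first by rewrite big_ord0 mulr0 ge_min lexx orbT.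
rewrite big_ord_recr/= mulrDr; have [Nv|vN] := ltP (delta * N%:R) v.
  rewrite min_r in IH; last exact: ltW.
  rewrite ge_min; apply/orP; right.
  by rewrite mulr1 -natr1 mulrDr mulr1 lerD2r.
rewrite min_l// in IH; rewrite mulr0 addr0 min_l//.
by rewrite (le_trans vN)// ler_wpM2l// ler_nat.
Qed.

(** If [k] is the last index counted, at most [k.+1] terms are nonzero, and [P k] bounds exactly
    [delta * k.+1]. *)
Lemma level_sum_le v delta N (P : nat -> bool) : 0 <= delta -> 0 <= v ->
  (forall k, P k -> delta * k.+1%:R <= v) ->
  delta * \sum_(k < N) (P k)%:R <= v.
Proof.
move=> d0 v0 Pv; elim: N => [|N IH]; first by rewrite big_ord0 mulr0.
rewrite big_ord_recr/=; case: (boolP (P N)) => [/Pv|_]; last by rewrite addr0.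
apply: le_trans; rewrite ler_wpM2l// -natr1 lerD2r -[leRHS]mulr1.
rewrite -[X in X%:R * 1]card_ord -sumr_const mulr1.
by apply: ler_sum => i _; case: (P i).
Qed.

End LevelSums.

(** * Brunn-Minkowski on the line *)

Section Line.
Context (R : realType).
Notation mu := (@lebesgue_measure R).
Implicit Types (A B : set (measurableTypeR R)).

Lemma lebesgue_measure_bounded A (M : R) : measurable A -> 0 <= M ->
  (forall x, A x -> `|x| <= M) -> (mu A <= (2 * M)%:E)%E.
Proof.
move=> mA M0 AM.
apply: (@le_trans _ _ (mu `[(- M)%R, M]%classic)).
  apply: le_measure; rewrite ?inE// => x /AM.
  by rewrite /= in_itv/= ler_norml.
rewrite lebesgue_measure_itv/=; case: ifPn => _.
  by rewrite -EFinB lee_fin; lra.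
by rewrite lee_fin; lra.
Qed.

(** Translate [A] by a point [b] near [inf B] and [B] by a point [a] near [sup A]: the two copies
    lie on either side of [a + b], so the measures add. [C] is a measurable part of the midpoint
    set, which may itself fail to be measurable. *)
Lemma brunn_minkowski_line A B (M e : R) : measurable A -> measurable B ->
  A !=set0 -> B !=set0 ->
  (forall x, A x -> `|x| <= M) -> (forall x, B x -> `|x| <= M) -> 0 < e ->
  exists C : set (measurableTypeR R), [/\ measurable C,
    forall z, C z -> exists x y, [/\ A x, B y & z = (x + y) / 2] &
    (mu A + mu B <= 2%:E * mu C + (2 * e)%:E)%E].
Proof.
move=> mA mB A0 B0 AM BM e0.
have supA : has_sup A.
  split=> //; exists M => x /AM; apply: le_trans; exact: ler_norm.
have infB : has_inf B.
  split=> //; exists (- M) => x /BM; rewrite ler_norml => /andP[].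
  by [].
have [a Aa aA] := sup_adherent e0 supA.
have [b Bb bB] := inf_adherent e0 infB.
(* Cutting at [a] and [b] makes the two copies disjoint; each cut loses measure at most [e]. *)
pose A' := A `&` [set x | x < a].
pose B' := B `&` [set x | b <= x].
have mA' : measurable A'.
  by apply: measurableI => //; rewrite -set_itvNyo; exact: measurable_itv.
have mB' : measurable B'.
  by apply: measurableI => //; rewrite -set_itvcy; exact: measurable_itv.
have maff (c : R) (D : set (measurableTypeR R)) : measurable D -> measurable [set z : measurableTypeR R | D (2 * z + c)].
  by move=> mD; have := measurable_affine R 2 c measurableT D mD; rewrite setTI.
pose C1 := [set z : measurableTypeR R | A' (2 * z + - b)].
pose C2 := [set z : measurableTypeR R | B' (2 * z + - a)].
exists (C1 `|` C2); split.
- by apply: measurableU; exact: maff.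
- move=> z [[Az _]|[Bz _]].
    by exists (2 * z + - b), b; split=> //; field.
  by exists a, (2 * z + - a); split=> //; field.
have AA' : (mu A <= mu A' + e%:E)%E.
  have -> : e%:E = mu (`[a, (a + e)%R]%classic).
    rewrite lebesgue_measure_itv/= lte_fin ltrDl e0 -EFinB.
    by congr EFin; ring.
  apply: le_trans (measureU2 _ _ _) => //.
  apply: le_measure; rewrite ?inE//; first by apply: measurableU => //.
  move=> x Ax; have [xa|ax] := ltP x a; [by left|right].
  rewrite /= in_itv/= ax/=.
  have : x <= sup A by apply: ub_le_sup => //; exact: supA.2.
  lra.
have BB' : (mu B <= mu B' + e%:E)%E.
  have -> : e%:E = mu (`[(b - e)%R, b]%classic).
    rewrite lebesgue_measure_itv/= lte_fin ltrBlDr ltrDl e0 -EFinB.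
    by congr EFin; ring.
  apply: le_trans (measureU2 _ _ _) => //.
  apply: le_measure; rewrite ?inE//; first by apply: measurableU => //.
  move=> x Bx; have [bx|xb] := leP b x; [by left|right].
  rewrite /= in_itv/= (ltW xb) andbT.
  have : inf B <= x by apply: ge_inf => //; exact: infB.2.
  lra.
rewrite measureU//; [|exact: maff|exact: maff|]; last first.
  rewrite -subset0 => z [[_ /= z1] [_ /= z2]]; lra.
rewrite ge0_muleDr// -!lebesgue_measure_affine//.
have -> : (2 * e)%:E = (e%:E + e%:E)%E by rewrite -EFinD; congr EFin; ring.
by rewrite addeACA; exact: leeD.
Qed.

End Line.

(** * Prekopa-Leindler at midpoints, on the line *)

Section PrekopaLeindlerLine.
Context (R : realType).
Notation mu := (@lebesgue_measure R).

Lemma le_of_forall_div (x y c : R) :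
  (forall N : nat, x <= y + c / N.+1%:R) -> x <= y.
Proof.
move=> xyc; rewrite leNgt; apply/negP => yx.
have d0 : 0 < x - y by rewrite subr_gt0.
pose N := Num.truncn (c / (x - y)).
have := truncnS_gt (c / (x - y)); rewrite -/N ltr_pdivrMr// => cN.
have := xyc N; rewrite leNgt => /negP; apply.
have N0 : 0 < N.+1%:R :> R by [].
by rewrite -ltrBrDl ltr_pdivrMr// mulrC.
Qed.

(* AM-GM for [I / a] and [J / b]. *)
Lemma mulr_le_sqr_of_mean (I J H a b c : R) : 0 <= I -> 0 <= J ->
  0 < a -> 0 < b -> 0 < c -> c ^+ 2 = a * b ->
  I / a + J / b <= 2 * H / c -> I * J <= H ^+ 2.
Proof.
move=> I0 J0 a0 b0 c0 cab IJ.
have p0 : 0 <= I / a by rewrite divr_ge0// ltW.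
have q0 : 0 <= J / b by rewrite divr_ge0// ltW.
have -> : I = (I / a) * a by rewrite divfK// gt_eqF.
have -> : J = (J / b) * b by rewrite divfK// gt_eqF.
have -> : H = (H / c) * c by rewrite divfK// gt_eqF.
rewrite exprMn cab mulrACA ler_pM2r ?mulr_gt0//.
move: IJ; rewrite -mulrA; set p := I / a; set q := J / b; set h := H / c => IJ.
have : 0 <= (p - q) ^+ 2 by exact: sqr_ge0.
have : (p + q) ^+ 2 <= (2 * h) ^+ 2.
  by rewrite lerXn2r// nnegrE; [exact: addr_ge0|exact: le_trans (addr_ge0 p0 q0) IJ].
nra.
Qed.

Lemma integral_indic_sum (A : nat -> set (measurableTypeR R)) (c : R) N :
  0 <= c -> (forall k, measurable (A k)) ->
  (\int[mu]_x (c * \sum_(k < N) \1_(A k) x)%:E = c%:E * \sum_(k < N) mu (A k))%E.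
Proof.
move=> c0 mA; transitivity
  (\int[mu]_x (c%:E * \sum_(k < N) (\1_(A k) x)%:E))%E.
  by apply: eq_integral => x _; rewrite EFinM sumEFin.
rewrite ge0_integralZl_EFin//; last 2 first.
- by move=> x _; apply: sume_ge0 => k _; rewrite lee_fin.
- by apply: emeasurable_sum => k; exact/measurable_EFinP/measurable_indic.
rewrite ge0_integral_sum//.
- by congr (_ * _)%E; apply: eq_bigr => k _; rewrite integral_indic// setIT.
- by move=> k; exact/measurable_EFinP/measurable_indic.
Qed.

Lemma ge0_integral_bounded (f : R -> \bar R) (K M : R) : 0 <= K -> 0 <= M ->
  (forall x, 0 <= f x <= K%:E)%E -> (forall x, M < `|x| -> f x = 0%E) ->
  (\int[mu]_x f x <= (2 * M * K)%:E)%E.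
Proof.
move=> K0 M0 fK fM.
apply: (@le_trans _ _ (\int[mu]_x (K * \1_(`[(- M)%R, M]%classic) x)%:E)%E).
  apply: ge0_le_lower_integral => x; first by case/andP: (fK x).
  rewrite indicE; case: (boolP (x \in _)) => [_|].
    by rewrite mulr1; case/andP: (fK x).
  rewrite notin_setE/= in_itv/= mulr0 => xM; rewrite fM// ltNge.
  by apply: contra_notN xM; rewrite ler_norml.
have mI : measurable (`[(- M)%R, M]%classic : set (measurableTypeR R)).
  exact: measurable_itv.
under eq_integral do rewrite EFinM.
rewrite ge0_integralZl_EFin//; last exact/measurable_EFinP/measurable_indic.
rewrite integral_indic// setIT mulrC EFinM lee_wpmul2l ?lee_fin//.
by apply: lebesgue_measure_bounded => // x; rewrite /= in_itv/= ler_norml.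
Qed.

(* The level sets [f > s] and [g > s] are rescaled to a common range, and the
   one-dimensional Brunn-Minkowski inequality is applied level by level. *)
Lemma prekopa_leindler_line_measurable (f g : measurableTypeR R -> R)
    (h : R -> \bar R) (K M : R) :
  measurable_fun setT f -> measurable_fun setT g -> 0 <= K -> 0 <= M ->
  (forall x, 0 <= f x <= K) -> (forall x, 0 <= g x <= K) ->
  (forall x, M < `|x| -> f x = 0) -> (forall x, M < `|x| -> g x = 0) ->
  (forall x, 0 <= h x)%E ->
  (forall x y, (f x * g y)%:E <= h ((x + y) / 2)%R * h ((x + y) / 2)%R)%E ->
  (\int[mu]_x (f x)%:E * \int[mu]_x (g x)%:E <=
   \int[mu]_x h x * \int[mu]_x h x)%E.
Proof.
move=> mf mg K0 M0 fK gK fM gM h0 fgh.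
have fsup : has_sup (range f).
  by split; [exists (f 0), 0|exists K => _ [x _ <-]; case/andP: (fK x)].
have gsup : has_sup (range g).
  by split; [exists (g 0), 0|exists K => _ [x _ <-]; case/andP: (gK x)].
pose a := sup (range f); pose b := sup (range g).
have fa x : f x <= a by apply: ub_le_sup; [exact: fsup.2|exists x].
have gb x : g x <= b by apply: ub_le_sup; [exact: gsup.2|exists x].
have f0 x : 0 <= f x by case/andP: (fK x).
have g0 x : 0 <= g x by case/andP: (gK x).
have hh0 : (0 <= \int[mu]_x h x * \int[mu]_x h x)%E.
  by apply: mule_ge0; apply: integral_ge0.
have [a0|a0] := leP a 0.
  rewrite integral0_eq ?mul0e// => x _; congr EFin.
  by apply/eqP; rewrite eq_le f0 (le_trans (fa x)).
have [b0|b0] := leP b 0.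
  rewrite [X in (_ * X)%E]integral0_eq ?mule0// => x _; congr EFin.
  by apply/eqP; rewrite eq_le g0 (le_trans (gb x)).
have [->|hfin] := eqVneq (\int[mu]_x h x)%E +oo%E.
  by rewrite mulyy leey.
have int0 F : (forall x, 0 <= F x)%E -> (0 <= \int[mu]_x F x)%E.
  by move=> F0; apply: integral_ge0.
have Ifin : (\int[mu]_x (f x)%:E)%E \is a fin_num.
  rewrite ge0_fin_numE; last by apply: int0 => x; rewrite lee_fin.
  apply: le_lt_trans (ge0_integral_bounded (EFin \o f) _ _ K0 M0 _ _) (ltry _).
    by move=> x; rewrite /= !lee_fin.
  by move=> x /fM /= ->.
have Jfin : (\int[mu]_x (g x)%:E)%E \is a fin_num.
  rewrite ge0_fin_numE; last by apply: int0 => x; rewrite lee_fin.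
  apply: le_lt_trans (ge0_integral_bounded (EFin \o g) _ _ K0 M0 _ _) (ltry _).
    by move=> x; rewrite /= !lee_fin.
  by move=> x /gM /= ->.
have Hfin : (\int[mu]_x h x)%E \is a fin_num.
  by rewrite ge0_fin_numE ?lt_neqAle ?hfin ?leey// int0.
(* Scaling [f], [g], [h] by [a], [b], [c] keeps the hypothesis because [c ^+ 2 = a * b], and gives
   [f] and [g] the common supremum 1, so that their level sets are nonempty at the same heights. *)
pose c := Num.sqrt (a * b).
have c0 : 0 < c by rewrite sqrtr_gt0 mulr_gt0.
have c2 : c ^+ 2 = a * b by rewrite sqr_sqrtr// ltW// mulr_gt0.
rewrite -(fineK Ifin) -(fineK Jfin) -(fineK Hfin) -!EFinM lee_fin -expr2.
apply: (@mulr_le_sqr_of_mean _ _ _ a b c) => //.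
  by apply: fine_ge0; apply: int0 => x; rewrite lee_fin.
  by apply: fine_ge0; apply: int0 => x; rewrite lee_fin.
(* At mesh [1 / n], the two level sets of height 0 cost [2 * M] each, and the Brunn-Minkowski errors
   [2 / n] on the [N] other levels add up to at most 2. *)
apply: (@le_of_forall_div _ _ (4 * M + 2)) => N.
pose n : R := N.+1%:R.
have n0 : 0 < n by rewrite ltr0n.
pose A k : set (measurableTypeR R) := [set x | a / n * k%:R < f x].
pose B k : set (measurableTypeR R) := [set x | b / n * k%:R < g x].
have levelmeas F (t : R) : measurable_fun setT F ->
    measurable ([set x | t < F x] : set (measurableTypeR R)).
  move=> mF; have := mF measurableT `]t, +oo[%classic (measurable_itv _).
  rewrite setTI; congr measurable.
  by apply/seteqP; split => x /=; rewrite in_itv/= andbT.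
have mA k : measurable (A k) by exact: levelmeas.
have mB k : measurable (B k) by exact: levelmeas.
have lt_level s (k : 'I_N) : 0 < s -> s / n * k.+1%:R < s.
  move=> s0; rewrite -mulrA gtr_pMr// mulrC ltr_pdivrMr// mul1r ltr_nat ltnS.
  exact: ltn_ord.
have pos_level s k : 0 < s -> 0 <= s / n * k%:R.
  by move=> s0; rewrite mulr_ge0// divr_ge0// ltW.
have AM k x : A k x -> `|x| <= M.
  rewrite /A/= => Ax; rewrite leNgt; apply/negP => /fM fx.
  by move: Ax; rewrite fx ltNge pos_level.
have BM k x : B k x -> `|x| <= M.
  rewrite /B/= => Bx; rewrite leNgt; apply/negP => /gM gx.
  by move: Bx; rewrite gx ltNge pos_level.
(* Brunn-Minkowski needs nonempty sets: the height [k.+1 / N.+1] is below the supremum 1 exactly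
   when [k < N]. Other indices get the empty set as a default. *)
have /choice[C CP] : forall k, exists C : set (measurableTypeR R),
    measurable C /\ ((k < N)%N ->
    (forall z, C z -> exists x y, [/\ A k.+1 x, B k.+1 y & z = (x + y) / 2]) /\
    (mu (A k.+1) + mu (B k.+1) <= 2%:E * mu C + (2 * n^-1)%:E)%E).
  move=> k.
  have [kN|kN] := ltnP k N; last by exists set0; split.
  have A0 : A k.+1 !=set0.
    have := sup_gt fsup.1 (lt_level a (Ordinal kN) a0).
    by move=> [_ [x _ <-] ?]; exists x.
  have B0 : B k.+1 !=set0.
    have := sup_gt gsup.1 (lt_level b (Ordinal kN) b0).
    by move=> [_ [x _ <-] ?]; exists x.
  have ni0 : 0 < n^-1 by rewrite invr_gt0.
  have [C [mC CAB le]] := brunn_minkowski_line _ _ _ _ _ (mA _) (mB _) A0 B0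
    (AM _) (BM _) ni0.
  by exists C; split.
have mC k : measurable (C k) := (CP k).1.
have hC (k : nat) z : (k < N)%N -> C k z -> ((c / n * k.+1%:R)%:E <= h z)%E.
  move=> kN Cz; have [x [y [Ax By ->]]] := ((CP k).2 kN).1 _ Cz.
  have := fgh x y; have := h0 ((x + y) / 2).
  case: (h _) => [r|_ _|//]; last by rewrite leey.
  rewrite lee_fin => r0; rewrite -EFinM !lee_fin -expr2 => fgr.
  rewrite -(@ler_pXn2r _ 2)// ?nnegrE ?pos_level//.
  apply: le_trans fgr.
  have -> : (c / n * k.+1%:R) ^+ 2 = (a / n * k.+1%:R) * (b / n * k.+1%:R).
    by rewrite !exprMn c2; ring.
  by apply: ler_pM; rewrite ?pos_level// ltW.
pose al k := fine (mu (A k)); pose be k := fine (mu (B k)).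
pose ga k := fine (mu (C k)).
have finle (D : set (measurableTypeR R)) : measurable D -> (forall x, D x -> `|x| <= M) ->
    mu D \is a fin_num.
  move=> mD DM; rewrite ge0_fin_numE//.
  exact: le_lt_trans (lebesgue_measure_bounded _ _ _ mD M0 DM) (ltry _).
have alE k : mu (A k) = (al k)%:E by rewrite fineK// finle//; exact: AM.
have beE k : mu (B k) = (be k)%:E by rewrite fineK// finle//; exact: BM.
have gaE (k : 'I_N) : mu (C k) = (ga k)%:E.
  rewrite fineK// finle// => z Cz.
  have [x [y [Ax By ->]]] := ((CP k).2 (ltn_ord k)).1 _ Cz.
  have := AM _ _ Ax; have := BM _ _ By; rewrite !ler_norml.
  by move=> /andP[? ?] /andP[? ?]; apply/andP; split; lra.
have upper (F : measurableTypeR R -> R) s (D : nat -> set (measurableTypeR R)) (de : nat -> R) : 0 < s ->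
    measurable_fun setT F -> (forall x, 0 <= F x <= s) ->
    (forall k, D k = [set x | s / n * k%:R < F x]) ->
    (forall k, mu (D k) = (de k)%:E) ->
    (forall k x, D k x -> `|x| <= M) ->
    (\int[mu]_x (F x)%:E <= (s / n * (2 * M + \sum_(k < N) de k.+1))%:E)%E.
  move=> s0 mF Fs DE deE DM.
  have mD k : measurable (D k) by rewrite DE; exact: levelmeas.
  apply: (@le_trans _ _ (\int[mu]_x (s / n * \sum_(k < N.+1) \1_(D k) x)%:E)%E).
    apply: ge0_le_lower_integral => x; first by rewrite lee_fin; case/andP: (Fs x).
    rewrite lee_fin.
    have -> : \sum_(k < N.+1) \1_(D k) x =
        \sum_(k < N.+1) (s / n * k%:R < F x)%R%:R :> R.
      apply: eq_bigr => k _; rewrite indicE DE; congr ((nat_of_bool _)%:R).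
      by apply/idP/idP; rewrite inE.
    apply: le_level_sum; first by rewrite divr_ge0// ltW.
    by rewrite divfK ?gt_eqF//; case/andP: (Fs x).
  have sn0 : 0 <= s / n by rewrite divr_ge0// ltW.
  rewrite integral_indic_sum// [leRHS]EFinM lee_wpmul2l//.
  rewrite big_ord_recl EFinD leeD//.
    by apply: lebesgue_measure_bounded => // x; exact: DM.
  rewrite -sumEFin; apply: lee_sum => k _.
  by rewrite deE.
have upA : (\int[mu]_x (f x)%:E <= (a / n * (2 * M + \sum_(k < N) al k.+1))%:E)%E.
  by apply: (upper f a A al) => // x; rewrite f0 fa.
have upB : (\int[mu]_x (g x)%:E <= (b / n * (2 * M + \sum_(k < N) be k.+1))%:E)%E.
  by apply: (upper g b B be) => // x; rewrite g0 gb.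
have loC : ((c / n * \sum_(k < N) ga k)%:E <= \int[mu]_x h x)%E.
  have cn0 : 0 <= c / n by rewrite divr_ge0// ltW.
  rewrite [leLHS]EFinM -sumEFin; under eq_bigr do rewrite -gaE.
  rewrite -integral_indic_sum//.
  apply: ge0_le_lower_integral => x.
    by rewrite lee_fin mulr_ge0// sumr_ge0.
  have hC' := hC _ x.
  have := h0 x; case: (h x) hC' => [r hCr|_ _|//]; last by rewrite leey.
  rewrite !lee_fin => r0.
  have -> : \sum_(k < N) \1_(C k) x =
        \sum_(k < N) ((k < N)%N && `[< C k x >])%:R :> R.
    apply: eq_bigr => k _; by rewrite ltn_ord indicE.
  apply: (level_sum_le _ _ _ _ (fun k => (k < N)%N && `[< C k x >])) => //.
  by move=> k /andP[kN /asboolP Cx]; have := hCr _ kN Cx; rewrite lee_fin.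
have sums : \sum_(k < N) al k.+1 + \sum_(k < N) be k.+1 <=
    2 * \sum_(k < N) ga k + 2.
  rewrite -big_split/= mulr_sumr.
  apply: (@le_trans _ _ (\sum_(k < N) (2 * ga k + 2 * n^-1))).
    apply: ler_sum => k _; have := ((CP k).2 (ltn_ord k)).2.
    by rewrite alE beE gaE -EFinM -!EFinD lee_fin.
  rewrite big_split/= lerD2l sumr_const card_ord -[leLHS]mulr_natr -mulrA.
  rewrite ger_pMr// mulrC ler_pdivrMr// mul1r ler_nat.
  exact: leqnSn.
move: upA upB loC; rewrite -{1}(fineK Ifin) -{1}(fineK Jfin) -{1}(fineK Hfin).
rewrite !lee_fin; set I := fine _; set J := fine _; set H := fine _.
move: sums; set Sa := \sum_(k < N) al k.+1; set Sb := \sum_(k < N) be k.+1.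
set Sc := \sum_(k < N) ga k => sums upA upB loC.
have IA : I / a <= (2 * M + Sa) / n.
  by rewrite ler_pdivrMr// (le_trans upA)//; rewrite le_eqVlt; apply/orP; left; apply/eqP; ring.
have JB : J / b <= (2 * M + Sb) / n.
  by rewrite ler_pdivrMr// (le_trans upB)//; rewrite le_eqVlt; apply/orP; left; apply/eqP; ring.
have HC : Sc / n <= H / c.
  by rewrite ler_pdivlMr// (le_trans _ loC)//; rewrite le_eqVlt; apply/orP; left; apply/eqP; ring.
apply: (le_trans (lerD IA JB)).
have -> : (2 * M + Sa) / n + (2 * M + Sb) / n = (Sa + Sb) / n + 4 * M / n by ring.
have sums' : (Sa + Sb) / n <= (2 * Sc + 2) / n.
  by rewrite ler_pM2r// invr_gt0.
apply: (le_trans (lerD sums' (lexx _))).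
have -> : (2 * Sc + 2) / n + 4 * M / n = 2 * (Sc / n) + (4 * M + 2) / n by ring.
by rewrite lerD2r -mulrA ler_pM2l.
Qed.

(** Replacing [f] and [g] by their measurable lower envelopes keeps their integrals and only weakens
    the hypothesis. This generality lets the induction on the dimension ignore measurability of
    inner integrals. *)
Lemma prekopa_leindler_line (f g h : R -> \bar R) (K M : R) :
  0 <= K -> 0 <= M ->
  (forall x, 0 <= f x <= K%:E)%E -> (forall x, 0 <= g x <= K%:E)%E ->
  (forall x, M < `|x| -> f x = 0%E) -> (forall x, M < `|x| -> g x = 0%E) ->
  (forall x, 0 <= h x)%E ->
  (forall x y, f x * g y <= h ((x + y) / 2)%R * h ((x + y) / 2)%R)%E ->
  (\int[mu]_x f x * \int[mu]_x g x <= \int[mu]_x h x * \int[mu]_x h x)%E.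
Proof.
move=> K0 M0 fK gK fM gM h0 fgh.
have f0 x : (0 <= f x)%E by case/andP: (fK x).
have g0 x : (0 <= g x)%E by case/andP: (gK x).
have [f' [mf f'0 ff <-]] := measurable_lower_envelope _ _ _ mu _ f0.
have [g' [mg g'0 gg <-]] := measurable_lower_envelope _ _ _ mu _ g0.
have f'E x : f' x = (fine (f' x))%:E.
  rewrite fineK// ge0_fin_numE// (le_lt_trans (ff x))//.
  by case/andP: (fK x) => _ /le_lt_trans -> //; rewrite ltry.
have g'E x : g' x = (fine (g' x))%:E.
  rewrite fineK// ge0_fin_numE// (le_lt_trans (gg x))//.
  by case/andP: (gK x) => _ /le_lt_trans -> //; rewrite ltry.
under eq_integral do rewrite f'E.
under [X in (_ * X <= _)%E]eq_integral do rewrite g'E.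
apply: (prekopa_leindler_line_measurable _ _ _ K M) => //.
- exact: measurableT_comp.
- exact: measurableT_comp.
- move=> x; rewrite -!lee_fin -f'E f'0 (le_trans (ff x))//.
  by case/andP: (fK x).
- move=> x; rewrite -!lee_fin -g'E g'0 (le_trans (gg x))//.
  by case/andP: (gK x).
- move=> x /fM fx; suff -> : f' x = 0%E by [].
  by apply/eqP; rewrite eq_le f'0 -{1}fx ff.
- move=> x /gM gx; suff -> : g' x = 0%E by [].
  by apply/eqP; rewrite eq_le g'0 -{1}gx gg.
- by move=> x y; rewrite EFinM -f'E -g'E (le_trans _ (fgh x y))// lee_pmul.
Qed.

End PrekopaLeindlerLine.

(** * Prekopa-Leindler and Brunn-Minkowski for iterated integrals *)

Section IteratedIntegral.
Context (R : realType).
Notation mu := (@lebesgue_measure R).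
Implicit Types (x y : nat -> R) (f g h : (nat -> R) -> \bar R).

Definition update x (m : nat) (t : R) : nat -> R :=
  fun j => if j == m then t else x j.

Definition midpoint x y : nat -> R := fun j => (x j + y j) / 2.

Lemma midpoint_update x y m s t :
  midpoint (update x m s) (update y m t) = update (midpoint x y) m ((s + t) / 2).
Proof. by apply/funext => j; rewrite /midpoint /update; case: eqP. Qed.

Lemma iter_intS m f x : iter_int m.+1 f x =
  (\int[mu]_t iter_int m f (update x m t))%E.
Proof. by []. Qed.

Lemma iter_int_ge0 m f x : (forall y, 0 <= f y)%E -> (0 <= iter_int m f x)%E.
Proof.
move=> f0; elim: m x => [|m IH] x; first exact: f0.
by apply: integral_ge0 => t _; exact: IH.
Qed.

Lemma eq_iter_int m f g x :
  (forall y, (forall j, (m <= j)%N -> y j = x j) -> f y = g y) ->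
  iter_int m f x = iter_int m g x.
Proof.
elim: m x => [|m IH] x fg; first exact: fg.
apply: eq_integral => t _; apply: IH => y yx; apply: fg => j mj.
by rewrite yx 1?ltnW// gtn_eqF.
Qed.

Lemma le_iter_int m f g x : (forall y, 0 <= f y)%E -> (forall y, f y <= g y)%E ->
  (iter_int m f x <= iter_int m g x)%E.
Proof.
move=> f0 fg; elim: m x => [|m IH] x; first exact: fg.
apply: ge0_le_lower_integral => t; last exact: IH.
exact: iter_int_ge0.
Qed.

Lemma iter_int_cst0 m x : iter_int m (fun=> 0%E) x = 0%E :> \bar R.
Proof. by elim: m x => // m IH x; apply: integral0_eq => t _; exact: IH. Qed.

Lemma iter_int_eq0 m f x :
  (forall y, (forall j, (m <= j)%N -> y j = x j) -> f y = 0%E) ->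
  iter_int m f x = 0%E.
Proof. by move=> f0; rewrite -(iter_int_cst0 m x); exact: eq_iter_int. Qed.

Lemma iter_intD m f g x : (forall y, 0 <= f y)%E -> (forall y, 0 <= g y)%E ->
  (iter_int m f x + iter_int m g x <= iter_int m (fun y => f y + g y) x)%E.
Proof.
move=> f0 g0; elim: m x => [|m IH] x //.
apply: le_trans (lower_integralD _ _ _ _ _ _ _ _) _.
- by move=> t; exact: iter_int_ge0.
- by move=> t; exact: iter_int_ge0.
apply: ge0_le_lower_integral => t; last exact: IH.
by apply: adde_ge0; exact: iter_int_ge0.
Qed.

Lemma iter_intZ m (k : R) f x : 0 <= k -> (forall y, 0 <= f y)%E ->
  (k%:E * iter_int m f x <= iter_int m (fun y => k%:E * f y) x)%E.
Proof.
move=> k0 f0; elim: m x => [|m IH] x //.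
apply: le_trans (lower_integralZ _ _ _ _ _ _ k0 _) _.
- by move=> t; exact: iter_int_ge0.
apply: ge0_le_lower_integral => t; last exact: IH.
by apply: mule_ge0; [rewrite lee_fin|exact: iter_int_ge0].
Qed.

Lemma iter_int_bounded m f (K M : R) x : 0 <= K -> 0 <= M ->
  (forall y, 0 <= f y <= K%:E)%E ->
  (forall y i, (i < m)%N -> M < `|y i| -> f y = 0%E) ->
  (iter_int m f x <= (K * (2 * M) ^+ m)%:E)%E.
Proof.
move=> K0 M0 fK; elim: m x => [|m IH] x fM.
  by rewrite expr0 mulr1; case/andP: (fK x).
have -> : K * (2 * M) ^+ m.+1 = 2 * M * (K * (2 * M) ^+ m) by rewrite exprS; ring.
apply: ge0_integral_bounded => //.
- by rewrite mulr_ge0// exprn_ge0// mulr_ge0.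
- move=> t; rewrite iter_int_ge0/=; last by move=> y; case/andP: (fK y).
  by apply: IH => y i im; apply: fM; exact: ltnW.
- move=> t tM; apply: iter_int_eq0 => y yx; apply: (fM _ m) => //.
  by rewrite yx// eqxx.
Qed.

(** The inner integrals, as functions of the outermost variable, satisfy the one-dimensional
    hypothesis by induction, because [midpoint] acts on each coordinate separately. The bounds [K]
    and [M] supply the boundedness required on the line. *)
Theorem prekopa_leindler n f g h (K M : R) : 0 <= K -> 0 <= M ->
  (forall x, 0 <= f x <= K%:E)%E -> (forall x, 0 <= g x <= K%:E)%E ->
  (forall x i, (i < n)%N -> M < `|x i| -> f x = 0%E) ->
  (forall x i, (i < n)%N -> M < `|x i| -> g x = 0%E) ->
  (forall x, 0 <= h x)%E ->
  (forall x y, f x * g y <= h (midpoint x y) * h (midpoint x y))%E ->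
  forall x y, (iter_int n f x * iter_int n g y <=
    iter_int n h (midpoint x y) * iter_int n h (midpoint x y))%E.
Proof.
move=> K0 M0 fK gK + + h0 fgh; elim: n => [|n IH] fM gM x y; first exact: fgh.
have f0 z : (0 <= f z)%E by case/andP: (fK z).
have g0 z : (0 <= g z)%E by case/andP: (gK z).
have fM' : forall x i, (i < n)%N -> M < `|x i| -> f x = 0%E.
  by move=> z i im; apply: fM; exact: ltnW.
have gM' : forall x i, (i < n)%N -> M < `|x i| -> g x = 0%E.
  by move=> z i im; apply: gM; exact: ltnW.
apply: (prekopa_leindler_line _ _ _ _ (K * (2 * M) ^+ n) M) => //.
- by rewrite mulr_ge0// exprn_ge0// mulr_ge0.
- by move=> t; rewrite iter_int_ge0//= iter_int_bounded.
- by move=> t; rewrite iter_int_ge0//= iter_int_bounded.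
- move=> t tM; apply: iter_int_eq0 => z zx; apply: (fM _ n) => //.
  by rewrite zx// eqxx.
- move=> t tM; apply: iter_int_eq0 => z zx; apply: (gM _ n) => //.
  by rewrite zx// eqxx.
- by move=> t; exact: iter_int_ge0.
- move=> s t; rewrite -/(update (midpoint x y) n ((s + t) / 2)).
  by rewrite -midpoint_update; exact: IH.
Qed.

Definition volume n (A : set (nat -> R)) : \bar R :=
  iter_int n (fun x => (\1_A x)%:E) (fun=> 0).

Lemma le_volume n (A B : set (nat -> R)) : A `<=` B ->
  (volume n A <= volume n B)%E.
Proof.
move=> AB; apply: le_iter_int => x; rewrite lee_fin//.
rewrite !indicE; case: (boolP (x \in A)) => [/set_mem/AB/mem_set ->|]//.
Qed.

Lemma le_of_mule_self (v w : \bar R) : (0 <= v)%E -> (0 <= w)%E ->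
  (v * v <= w * w)%E -> (v <= w)%E.
Proof.
case: v => [v| |]; case: w => [w| |] //=; rewrite ?leey ?mulyy//.
rewrite -!EFinM !lee_fin => v0 w0.
by rewrite -!expr2 ler_pXn2r// nnegrE.
Qed.

(** On indicators, Prekopa-Leindler bounds the product of the two volumes by the square of the
    third. Carrying a common lower bound [v] avoids [n]-th roots. *)
Lemma volume_midpoint n (A B C : set (nat -> R)) (M : R) (v : \bar R) :
  0 <= M -> (0 <= v)%E ->
  (forall x i, (i < n)%N -> A x -> `|x i| <= M) ->
  (forall x i, (i < n)%N -> B x -> `|x i| <= M) ->
  (v <= volume n A)%E -> (v <= volume n B)%E ->
  (forall x y, A x -> B y -> C (midpoint x y)) -> (v <= volume n C)%E.
Proof.
move=> M0 v0 AM BM vA vB ABC; apply: le_of_mule_self => //.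
  by apply: iter_int_ge0 => x; rewrite lee_fin.
have ind (D : set (nat -> R)) : forall x, (0 <= (\1_D x : R)%:E <= 1%:E)%E.
  by move=> x; rewrite !lee_fin indicE; case: (x \in D); rewrite ?ler01 ?lexx.
have sup (D : set (nat -> R)) : (forall x i, (i < n)%N -> D x -> `|x i| <= M) ->
    forall x i, (i < n)%N -> M < `|x i| -> (\1_D x)%:E = 0%E :> \bar R.
  move=> DM x i im xM; rewrite indicE memNset// => Dx.
  by move: xM; rewrite ltNge (DM x i).
have -> : volume n C = iter_int n (fun x => (\1_C x)%:E) (midpoint (fun=> 0) (fun=> 0)).
  by congr iter_int; apply/funext => j; rewrite /midpoint addr0 mul0r.
apply: le_trans (prekopa_leindler _ _ _ _ 1 M _ M0 (ind A) (ind B)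
  (sup A AM) (sup B BM) _ _ _ _) => //.
- by apply: lee_pmul.
- move=> x y; rewrite -!EFinM lee_fin !indicE.
  case: (boolP (x \in A)) => [/set_mem Ax|_]; last by rewrite mul0r mulr_ge0.
  case: (boolP (y \in B)) => [/set_mem By|_]; last by rewrite mulr0 mulr_ge0.
  by rewrite mem_set ?mulr1//; exact: ABC.
Qed.

Lemma sum_double (F : nat -> R) k :
  \sum_(j < k.*2) F j = \sum_(j < k) (F j.*2 + F j.*2.+1).
Proof.
elim: k => [|k IH]; first by rewrite !big_ord0.
by rewrite doubleS !big_ord_recr/= IH addrA.
Qed.

(** Induction along a binary tree: the sets of indices [j.*2] and [j.*2.+1] are merged into their
    midpoint set, which keeps the bounds [M] and [v] and halves the number of sets. *)
Theorem brunn_minkowski_dyadic n m (A : nat -> set (nat -> R))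
    (H : set (nat -> R)) (M : R) (v : \bar R) :
  0 <= M -> (0 <= v)%E ->
  (forall j x i, (j < 2 ^ m)%N -> (i < n)%N -> A j x -> `|x i| <= M) ->
  (forall j, (j < 2 ^ m)%N -> (v <= volume n (A j))%E) ->
  (forall X : nat -> nat -> R, (forall j, (j < 2 ^ m)%N -> A j (X j)) ->
    H (fun i => (\sum_(j < 2 ^ m) X j i) / (2 ^ m)%:R)) ->
  (v <= volume n H)%E.
Proof.
move=> M0 v0; elim: m A => [|m IH] A AM vA AH.
  apply: le_trans (vA 0%N _) _ => //; apply: le_volume => x Ax.
  have -> : x = fun i => (\sum_(j < 2 ^ 0) x i) / (2 ^ 0)%:R.
    by apply/funext => i; rewrite expn0 big_ord1 divr1.
  by apply: (AH (fun=> x)) => -[].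
have lt2 j : (j < 2 ^ m)%N -> (j.*2 < 2 ^ m.+1)%N /\ (j.*2.+1 < 2 ^ m.+1)%N.
  by rewrite expnS mul2n ltn_double ltn_Sdouble.
apply: (IH (fun j => [set z | exists x y,
    [/\ A j.*2 x, A j.*2.+1 y & z = midpoint x y]])).
- move=> j z i /lt2[j1 j2] im [x [y [Ax Ay ->]]].
  have := AM _ _ _ j1 im Ax; have := AM _ _ _ j2 im Ay; rewrite !ler_norml.
  by rewrite /midpoint => /andP[? ?] /andP[? ?]; apply/andP; split; lra.
- move=> j /lt2[j1 j2].
  apply: (@volume_midpoint n (A j.*2) (A j.*2.+1) _ M) => //.
  + by move=> x i; exact: AM.
  + by move=> x i; exact: AM.
  + exact: vA.
  + exact: vA.
  + by move=> x y Ax Ay; exists x, y.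
- move=> Z ZA.
  have /choice[XY XYP] : forall j, exists xy : (nat -> R) * (nat -> R),
      (j < 2 ^ m)%N -> [/\ A j.*2 xy.1, A j.*2.+1 xy.2 & Z j = midpoint xy.1 xy.2].
    move=> j; have [jm|jm] := ltnP j (2 ^ m); last by exists (Z j, Z j).
    by have [x [y xyP]] := ZA _ jm; exists (x, y).
  (* Interleaves the two halves of each pair, so that the mean of the [X j] is the mean of the
     midpoints [Z j]. *)
  pose X j := if odd j then (XY j./2).2 else (XY j./2).1.
  have XE k : X k.*2 = (XY k).1 by rewrite /X odd_double doubleK.
  have XO k : X k.*2.+1 = (XY k).2 by rewrite /X /= odd_double uphalf_double.
  have := AH X; have -> : (fun i => (\sum_(j < 2 ^ m.+1) X j i) / (2 ^ m.+1)%:R) =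
      (fun i => (\sum_(j < 2 ^ m) Z j i) / (2 ^ m)%:R).
    apply/funext => i; rewrite expnS mul2n (sum_double (X ^~ i)) -mul2n.
    have -> : \sum_(j < 2 ^ m) (X j.*2 i + X j.*2.+1 i) =
        2 * \sum_(j < 2 ^ m) Z j i.
      rewrite mulr_sumr; apply: eq_bigr => j _.
      have [_ _ ->] := XYP _ (ltn_ord j).
      by rewrite XE XO /midpoint; field.
    by rewrite natrM -mulf_div divff// mul1r.
  apply => j jm.
  have j2 : (j./2 < 2 ^ m)%N by rewrite ltn_half_double -mul2n -expnS.
  have [A1 A2 _] := XYP _ j2.
  rewrite /X -[in A j](odd_double_half j).
  by case: (odd j); rewrite ?add1n ?add0n.
Qed.

End IteratedIntegral.

(** * Measurability and reordering of iterated integrals *)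

Section Tonelli.
Context (R : realType).
Notation mu := (@lebesgue_measure R).
Implicit Types (x y : nat -> R) (f g : (nat -> R) -> \bar R).

(* Measurability for the product sigma-algebra on [nat -> R], phrased through
   its universal property. *)
Definition cylinder_measurable f := forall d (T : measurableType d)
  (phi : T -> nat -> R),
  (forall i, measurable_fun setT (fun z => phi z i)) ->
  measurable_fun setT (fun z => f (phi z)).

(** The result is kept as a function of all coordinates, constant in the [i]-th, so that these
    operators compose and commute. *)
Definition coord_int (i : nat) f : (nat -> R) -> \bar R :=
  fun x => (\int[mu]_t f (update R x i t))%E.

Lemma updateC x i j s t : i != j ->
  update R (update R x i s) j t = update R (update R x j t) i s.
Proof.
move=> ij; apply/funext => k; rewrite /update.
by case: eqP => // ->; case: eqP => // ji; rewrite ji eqxx in ij.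
Qed.

Lemma measurable_update d (T : measurableType d) (phi : T -> nat -> R) i j :
  (forall k, measurable_fun setT (fun z => phi z k)) ->
  measurable_fun setT
    (fun zt : T * measurableTypeR R => update R (phi zt.1) i zt.2 j).
Proof.
move=> mphi; rewrite /update; case: (j == i); first exact: measurable_snd.
exact: (measurableT_comp (mphi j) measurable_fst).
Qed.

(** The integration variable joins the parameter space: apply the hypothesis on [f] to the product
    of [T] with the line, then the measurability part of Tonelli. *)
Lemma cylinder_measurable_coord_int i f : (forall x, 0 <= f x)%E ->
  cylinder_measurable f -> cylinder_measurable (coord_int i f).
Proof.
move=> f0 mf d T phi mphi.
pose F (zt : T * measurableTypeR R) := f (update R (phi zt.1) i zt.2).
apply: (@measurable_fun_fubini_tonelli_F _ _ _ _ _ mu F) => //.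
  by apply: mf => j; exact: measurable_update.
by move=> zt; exact: f0.
Qed.

Lemma cylinder_measurable_iter_int m f : (forall x, 0 <= f x)%E ->
  cylinder_measurable f -> cylinder_measurable (iter_int m f).
Proof.
move=> f0 mf; elim: m => // m IH.
apply: (cylinder_measurable_coord_int m (iter_int m f)) => // x.
exact: iter_int_ge0.
Qed.

Lemma measurable_line f x i : cylinder_measurable f ->
  measurable_fun setT (fun t : measurableTypeR R => f (update R x i t)).
Proof.
move=> mf; apply: (mf _ _ (fun t : measurableTypeR R => update R x i t)) => j.
rewrite /update; case: (j == i); first exact: measurable_id.
exact: measurable_cst.
Qed.

Lemma coord_intC i j f x : i != j -> (forall x, 0 <= f x)%E ->
  cylinder_measurable f ->
  coord_int i (coord_int j f) x = coord_int j (coord_int i f) x.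
Proof.
move=> ij f0 mf.
pose F (st : measurableTypeR R * measurableTypeR R) :=
  f (update R (update R x i st.1) j st.2).
transitivity (\int[mu]_s \int[mu]_t F (s, t))%E; first by [].
rewrite (fubini_tonelli F).
- apply: eq_integral => t _; apply: eq_integral => s _.
  by rewrite /F/= updateC.
- apply: mf => k; apply: (measurable_update _ _ (fun s => update R x i s)) => l.
  rewrite /update; case: (l == i); first exact: measurable_id.
  exact: measurable_cst.
- by move=> st; exact: f0.
Qed.

Lemma iter_int_coord_int k i f x : (k <= i)%N -> (forall x, 0 <= f x)%E ->
  cylinder_measurable f ->
  iter_int k (coord_int i f) x = coord_int i (iter_int k f) x.
Proof.
move=> + f0 mf; elim: k x => // k IH x ki.
transitivity (coord_int k (coord_int i (iter_int k f)) x).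
  by apply: eq_integral => t _; apply: IH; exact: ltnW.
rewrite coord_intC// ?ltn_eqF//; first by move=> y; exact: iter_int_ge0.
exact: cylinder_measurable_iter_int.
Qed.

(** Tonelli moves coordinate [i] to the innermost place. A change of variables in one coordinate
    then needs checking only on lines parallel to that axis. *)
Lemma eq_iter_int_coord_int m i f g x : (i < m)%N ->
  (forall x, 0 <= f x)%E -> (forall x, 0 <= g x)%E ->
  cylinder_measurable f -> cylinder_measurable g ->
  (forall x, coord_int i f x = coord_int i g x) ->
  iter_int m f x = iter_int m g x.
Proof.
move=> + f0 g0 mf mg fg; elim: m x => // m IH x.
rewrite ltnS leq_eqVlt => /predU1P[im|im]; last first.
  by apply: eq_integral => t _; exact: IH.
subst i; transitivity (iter_int m (coord_int m f) x).
  exact/esym/iter_int_coord_int.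
transitivity (iter_int m (coord_int m g) x); last exact: iter_int_coord_int.
by apply: eq_iter_int => y _; exact: fg.
Qed.

End Tonelli.

(** * Lens volumes: invariance under rotation and monotonicity *)

Section Lens.
Context (R : realType).
Notation mu := (@lebesgue_measure R).
Implicit Types (x y w : nat -> R) (f g : (nat -> R) -> \bar R).

Definition sumsq n x : R := \sum_(i < n) x i ^+ 2.

(** An intersection of two open balls; [s] is the squared radius, which keeps square roots out of
    the computations. *)
Definition lens n (s : R) w : set (nat -> R) :=
  [set x | sumsq n x < s /\ sumsq n (fun i => x i + w i) < s].

Lemma cylinder_measurable_lens n s w :
  cylinder_measurable R (fun x => (\1_(lens n s w) x)%:E).
Proof.
move=> d T phi mphi.
have msq v : measurable_fun setT (fun z => sumsq n (fun i => phi z i + v i)).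
  apply: measurable_sum => i; apply: measurable_funX.
  by apply: measurable_funD => //; exact: measurable_cst.
have mlt v : measurable [set z | sumsq n (fun i => phi z i + v i) < s].
  have -> : [set z | sumsq n (fun i => phi z i + v i) < s] = setT `&`
      (fun z => sumsq n (fun i => phi z i + v i)) @^-1` `]-oo, s[%classic.
    by rewrite setTI; apply/seteqP; split => z /=; rewrite in_itv.
  exact: msq v measurableT _ (measurable_itv _).
have mA : measurable ([set z | sumsq n (fun i => phi z i + 0) < s] `&`
    [set z | sumsq n (fun i => phi z i + w i) < s]).
  exact: measurableI (mlt (fun=> 0)) (mlt w).
set A := (X in measurable X) in mA.
suff -> : (fun z => (\1_(lens n s w) (phi z) : R)%:E) = EFin \o (\1_A : T -> R).
  by apply/measurable_EFinP/measurable_indic.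
apply/funext => z; rewrite /= !indicE; congr ((nat_of_bool _)%:R%:E).
rewrite /A; have E : (fun i => phi z i + 0) = phi z by apply/funext => i; rewrite addr0.
by apply/idP/idP => /set_mem; rewrite /lens/= => zL; apply/mem_set; move: zL; rewrite /= E.
Qed.

Definition shear (i j : nat) (c : R) x := update R x i (x i + c * x j).

Lemma cylinder_measurable_shear i j c f : cylinder_measurable R f ->
  cylinder_measurable R (fun x => f (shear i j c x)).
Proof.
move=> mf d T phi mphi; apply: (mf _ _ (fun z => shear i j c (phi z))) => k.
rewrite /shear /update; case: (k == i) => //.
by apply: measurable_funD => //; exact: measurable_funM.
Qed.

(** Since [i != j], the term [c * x j] is constant on a line along coordinate [i], where the shear
    is a translation. *)
Lemma iter_int_shear m i j c f x : (i < m)%N -> i != j ->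
  (forall x, 0 <= f x)%E -> cylinder_measurable R f ->
  iter_int m (fun x => f (shear i j c x)) x = iter_int m f x.
Proof.
move=> im ij f0 mf; apply: (eq_iter_int_coord_int _ _ i) => //.
  exact: cylinder_measurable_shear.
move=> y; rewrite /coord_int.
rewrite -[RHS](ge0_integral_translation _ (c * y j)); last 2 first.
- exact: measurable_line.
- by move=> t; exact: f0.
apply: eq_integral => t _; congr f; apply/funext => k.
by rewrite /shear /update eqxx [j == i]eq_sym (negbTE ij); case: eqP.
Qed.

Lemma iter_int_translation m i c f x : (i < m)%N ->
  (forall x, 0 <= f x)%E -> cylinder_measurable R f ->
  iter_int m (fun x => f (update R x i (x i + c))) x = iter_int m f x.
Proof.
move=> im f0 mf; apply: (eq_iter_int_coord_int _ _ i) => //.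
  move=> d T phi mphi.
  apply: (mf _ _ (fun z => update R (phi z) i (phi z i + c))) => k.
  rewrite /update; case: (k == i) => //.
  by apply: measurable_funD => //; exact: measurable_cst.
move=> y; rewrite /coord_int.
rewrite -[RHS](ge0_integral_translation _ c); last 2 first.
- exact: measurable_line.
- by move=> t; exact: f0.
apply: eq_integral => t _; congr f; apply/funext => k.
by rewrite /update eqxx; case: eqP.
Qed.

(* The rotation of cosine [c] and sine [s] in the plane of the coordinates 0 and
   [j], as a product of three shears. *)
Definition rotation (j : nat) (c s : R) x :=
  shear 0 j ((c - 1) / s) (shear j 0 s (shear 0 j ((c - 1) / s) x)).

Lemma rotationE j c s x : (0 < j)%N -> s != 0 -> c ^+ 2 + s ^+ 2 = 1 ->
  rotation j c s x =
  update R (update R x j (s * x 0%N + c * x j)) 0 (c * x 0%N - s * x j).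
Proof.
move=> j0 s0 cs; have j0' : (j == 0%N) = false by rewrite gtn_eqF.
apply/funext => k; rewrite /rotation /shear /update.
rewrite eqxx [0%N == j]eq_sym j0' !eqxx.
case: (eqVneq k 0%N) => [_|k0].
  (* The last summand vanishes because [c ^+ 2 + s ^+ 2 = 1]; including it makes the equality an
     identity in [c] and [s] that [field] can check. *)
  have -> : c * x 0%N - s * x j = x 0%N + (c - 1) / s * x j +
      (c - 1) / s * (x j + s * (x 0%N + (c - 1) / s * x j)) +
      (1 - (c ^+ 2 + s ^+ 2)) / s * x j by field.
  by rewrite cs subrr mul0r mul0r addr0.
by case: eqVneq => // _; field.
Qed.

Lemma iter_int_rotation m j c s f x : (0 < j < m)%N ->
  (forall x, 0 <= f x)%E -> cylinder_measurable R f ->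
  iter_int m (fun x => f (rotation j c s x)) x = iter_int m f x.
Proof.
move=> /andP[j0 jm] f0 mf; have m0 : (0 < m)%N by exact: leq_ltn_trans jm.
have j0' : j != 0%N by rewrite gtn_eqF.
have mf1 := cylinder_measurable_shear 0 j ((c - 1) / s) _ mf.
have mf2 := cylinder_measurable_shear j 0 s _ mf1.
rewrite /rotation (iter_int_shear m 0 j _ (fun x =>
  f (shear 0 j ((c - 1) / s) (shear j 0 s x))))//; last by rewrite eq_sym.
rewrite (iter_int_shear m j 0 _ (fun x => f (shear 0 j ((c - 1) / s) x)))//.
by rewrite iter_int_shear// eq_sym.
Qed.

Lemma eq_sumsq_plane n j x y : (0 < j < n)%N ->
  (forall i, i != 0%N -> i != j -> x i = y i) ->
  x 0%N ^+ 2 + x j ^+ 2 = y 0%N ^+ 2 + y j ^+ 2 -> sumsq n x = sumsq n y.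
Proof.
move=> /andP[j0 jn] xy xy0; have n0 : (0 < n)%N by exact: leq_ltn_trans jn.
have split z : sumsq n z = (z 0%N ^+ 2 + z j ^+ 2) +
    \sum_(i < n | (i != Ordinal n0) && (i != Ordinal jn)) z i ^+ 2.
  rewrite /sumsq (bigD1 (Ordinal n0))//= (bigD1 (Ordinal jn))/= ?addrA//.
  by rewrite -val_eqE/= gtn_eqF.
rewrite !split xy0; congr +%R; apply: eq_bigr => i /andP[i0 ij].
by rewrite xy.
Qed.

Lemma sumsq_rotation n j c s x : (0 < j < n)%N -> s != 0 ->
  c ^+ 2 + s ^+ 2 = 1 -> sumsq n (rotation j c s x) = sumsq n x.
Proof.
move=> /[dup] jn /andP[j0 _] s0 cs; apply: (eq_sumsq_plane _ j) => //.
  by move=> i i0 ij; rewrite rotationE// /update (negbTE i0) (negbTE ij).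
rewrite rotationE// /update eqxx gtn_eqF// eqxx.
transitivity ((c ^+ 2 + s ^+ 2) * (x 0%N ^+ 2 + x j ^+ 2)); first by ring.
by rewrite cs mul1r.
Qed.

Lemma rotationD j c s x y : (0 < j)%N -> s != 0 -> c ^+ 2 + s ^+ 2 = 1 ->
  rotation j c s (fun i => x i + y i) =
  (fun i => rotation j c s x i + rotation j c s y i).
Proof.
move=> j0 s0 cs; rewrite !rotationE//; apply/funext => k; rewrite /update.
by case: eqP => _; [ring|case: eqP => _ //; ring].
Qed.

Lemma volume_lens_rotation n j c s t w : (0 < j < n)%N -> s != 0 ->
  c ^+ 2 + s ^+ 2 = 1 ->
  volume R n (lens n t (rotation j c s w)) = volume R n (lens n t w).
Proof.
move=> /[dup] jn /andP[j0 _] s0 cs.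
rewrite /volume -(iter_int_rotation n j c s (fun x =>
  (\1_(lens n t (rotation j c s w)) x)%:E))//.
  apply: eq_iter_int => y _; rewrite !indicE; congr ((nat_of_bool _)%:R%:E).
  have E : sumsq n (fun i => rotation j c s y i + rotation j c s w i) =
      sumsq n (fun i => y i + w i) by rewrite -rotationD// sumsq_rotation.
  by apply/idP/idP => /set_mem yL; apply/mem_set; move: yL;
    rewrite /lens/= E sumsq_rotation.
exact: cylinder_measurable_lens.
Qed.

(** A rotation in the plane of coordinates 0 and [j] carries [w'], whose components there are [rho]
    and 0, onto [w]. The sine is [w j / rho], hence the separate case [w j = 0]: the shear
    factorisation divides by the sine. *)
Lemma volume_lens_eliminate n j t w : (0 < j < n)%N ->
  exists w', [/\ w' j = 0, forall i, i != 0%N -> i != j -> w' i = w i,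
    sumsq n w' = sumsq n w &
    volume R n (lens n t w') = volume R n (lens n t w)].
Proof.
move=> /[dup] jn /andP[j0 _].
have j0' : (j == 0%N) = false by rewrite gtn_eqF.
have [wj|wj] := eqVneq (w j) 0; first by exists w.
pose rho := Num.sqrt (w 0%N ^+ 2 + w j ^+ 2).
have rho2 : rho ^+ 2 = w 0%N ^+ 2 + w j ^+ 2.
  by rewrite sqr_sqrtr// addr_ge0// sqr_ge0.
have rho0 : rho != 0.
  rewrite gt_eqF// sqrtr_gt0 ltr_pwDr ?sqr_ge0//.
  by rewrite lt_neqAle sqr_ge0 andbT eq_sym sqrf_eq0.
have s0 : w j / rho != 0 by rewrite mulf_neq0// invr_eq0.
have cs : (w 0%N / rho) ^+ 2 + (w j / rho) ^+ 2 = 1.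
  by rewrite !expr_div_n -mulrDl -rho2 divff// expf_neq0.
pose w' := update R (update R w 0 rho) j 0.
have rw : rotation j (w 0%N / rho) (w j / rho) w' = w.
  rewrite rotationE//; apply/funext => k; rewrite /w' /update.
  rewrite [0%N == j]eq_sym j0' !eqxx.
  have [->|k0] := eqVneq k 0%N; first by field.
  by have [->|kj] := eqVneq k j => //; field.
exists w'; split.
- by rewrite /w' /update eqxx.
- by move=> i i0 ij; rewrite /w' /update (negbTE i0) (negbTE ij).
- by rewrite -(sumsq_rotation n j (w 0%N / rho) (w j / rho) w')// rw.
- by rewrite -(volume_lens_rotation n j (w 0%N / rho) (w j / rho) t w')// rw.
Qed.

Lemma volume_lens_axis n t w : (0 < n)%N ->
  exists w', [/\ forall i, (0 < i < n)%N -> w' i = 0,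
    w' 0%N ^+ 2 = sumsq n w &
    volume R n (lens n t w') = volume R n (lens n t w)].
Proof.
move=> n0.
have : forall k, (k <= n)%N -> exists w',
    [/\ forall i, (0 < i < k)%N -> w' i = 0, sumsq n w' = sumsq n w &
    volume R n (lens n t w') = volume R n (lens n t w)].
  elim=> [|[|k] IH] kn; first by exists w; split => // i; rewrite ltn0 andbF.
    by exists w; split => // i /andP[i0]; rewrite ltnS leqNgt i0.
  have [w1 [w1z w1s w1v]] := IH (ltnW kn).
  have [|w2 [w2k w2i w2s w2v]] := volume_lens_eliminate n k.+1 t w1.
    by rewrite /= kn.
  exists w2; split; rewrite ?w2s ?w2v// => i /andP[i0].
  rewrite ltnS leq_eqVlt => /predU1P[->//|ik].
  rewrite w2i; [by apply: w1z; rewrite i0|by rewrite gtn_eqF|].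
  by rewrite ltn_eqF.
move=> /(_ n (leqnn n))[w' [w'z w's w'v]]; exists w'; split => //.
rewrite -w's /sumsq (bigD1 (Ordinal n0))//= big1 ?addr0// => i i0.
rewrite w'z ?expr0n// ltn_ord andbT lt0n.
by apply: contra i0 => /eqP i0; apply/eqP/val_inj.
Qed.

(* Centring the lens along its axis turns the comparison into an inclusion. *)
Theorem volume_lens_mono n t w1 w2 : (0 < n)%N -> sumsq n w1 <= sumsq n w2 ->
  (volume R n (lens n t w2) <= volume R n (lens n t w1))%E.
Proof.
move=> n0 w12.
have [a [az a2 <-]] := volume_lens_axis n t w1 n0.
have [b [bz b2 <-]] := volume_lens_axis n t w2 n0.
have split x : sumsq n x = x 0%N ^+ 2 + \sum_(i < n | i != Ordinal n0) x i ^+ 2.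
  by rewrite /sumsq (bigD1 (Ordinal n0)).
have nz (i : 'I_n) : i != Ordinal n0 -> (0 < i)%N.
  rewrite lt0n; apply: contra => /eqP i0; exact/eqP/val_inj.
(* Moving the origin to the centre of the lens turns its two conditions into bounds on the squares
   of [x 0 - w 0 / 2] and [x 0 + w 0 / 2]. *)
have centre w x : (forall i, (0 < i < n)%N -> w i = 0) ->
    lens n t w (update R x 0 (x 0%N + - (w 0%N / 2))) <->
    (x 0%N - w 0%N / 2) ^+ 2 + \sum_(i < n | i != Ordinal n0) x i ^+ 2 < t /\
    (x 0%N + w 0%N / 2) ^+ 2 + \sum_(i < n | i != Ordinal n0) x i ^+ 2 < t.
  move=> wz; rewrite /lens/= !split.
  have -> : update R x 0 (x 0%N + - (w 0%N / 2)) 0%N + w 0%N = x 0%N + w 0%N / 2.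
    by rewrite /update eqxx; field.
  have E i : i != Ordinal n0 -> update R x 0 (x 0%N + - (w 0%N / 2)) i = x i.
    by move=> i0; rewrite /update gtn_eqF// nz.
  have -> : \sum_(i < n | i != Ordinal n0)
      (update R x 0 (x 0%N + - (w 0%N / 2)) i + w i) ^+ 2 =
      \sum_(i < n | i != Ordinal n0) x i ^+ 2.
    by apply: eq_bigr => i i0; rewrite E// wz ?addr0// nz//=.
  have -> : \sum_(i < n | i != Ordinal n0)
      (update R x 0 (x 0%N + - (w 0%N / 2)) i) ^+ 2 =
      \sum_(i < n | i != Ordinal n0) x i ^+ 2.
    by apply: eq_bigr => i i0; rewrite E.
  by rewrite {1}/update eqxx.
have ind0 (A : set (nat -> R)) : forall x, (0 <= (\1_A x : R)%:E)%E.
  by move=> x; rewrite lee_fin.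
rewrite /volume -(iter_int_translation n 0 (- (a 0%N / 2)) (fun x =>
  (\1_(lens n t a) x)%:E))//; last exact: cylinder_measurable_lens.
rewrite -(iter_int_translation n 0 (- (b 0%N / 2)) (fun x =>
  (\1_(lens n t b) x)%:E))//; last exact: cylinder_measurable_lens.
apply: le_iter_int => x //; rewrite lee_fin !indicE.
case: (boolP (_ \in lens n t b)) => [/set_mem/(centre b _ bz)[b1 b3]|_]//.
rewrite mem_set//; apply/(centre a _ az).
have ab : `|a 0%N| <= `|b 0%N|.
  by rewrite -(@ler_pXn2r _ 2)// ?nnegrE// -!normrX !ger0_norm ?sqr_ge0// a2 b2.
have xab : `|x 0%N * a 0%N| <= `|x 0%N * b 0%N| by rewrite !normrM ler_wpM2l.
have ab2 : a 0%N ^+ 2 <= b 0%N ^+ 2 by rewrite a2 b2.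
move: b1 b3; set q := \sum_(i < n | _) _.
have sqB u v : (u - v / 2) ^+ 2 = u ^+ 2 - u * v + v ^+ 2 / 4 :> R by field.
have sqD u v : (u + v / 2) ^+ 2 = u ^+ 2 + u * v + v ^+ 2 / 4 :> R by field.
rewrite !sqB !sqD => b1 b3.
(* Together the two conditions bound the absolute value of [x 0 * b 0] by a quantity that decreases
   with [b 0 ^+ 2]; passing from [b] to [a] relaxes both sides. *)
have : `|x 0%N * b 0%N| < t - q - x 0%N ^+ 2 - b 0%N ^+ 2 / 4.
  by rewrite ltr_norml; apply/andP; split; lra.
move=> /(le_lt_trans xab); rewrite ltr_norml => /andP[? ?].
by split; lra.
Qed.

End Lens.

(** * Exhausting the unit lens by smaller ones *)

Section MonotoneLimit.
Context (R : realType).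
Implicit Types (x y w : nat -> R).

Lemma iter_int_limn m (f : nat -> (nat -> R) -> \bar R) x :
  (forall k y, 0 <= f k y)%E -> (forall k, cylinder_measurable R (f k)) ->
  (forall y, nondecreasing_seq (f ^~ y)) ->
  iter_int m (fun y => limn (f ^~ y)) x = limn (fun k => iter_int m (f k) x).
Proof.
move=> f0 mf ndf; elim: m x => // m IH x.
rewrite iter_intS; under eq_integral do rewrite IH.
rewrite monotone_convergence//.
- move=> k; apply: (measurable_line _ (iter_int m (f k))).
  by apply: cylinder_measurable_iter_int => //; exact: f0.
- by move=> k t _; apply: iter_int_ge0 => y; exact: f0.
- move=> t _ j k jk; apply: le_iter_int => y; first exact: f0.
  exact: ndf.
Qed.

(** The strict inequalities make the lens of squared radius 1 the increasing union of those with
    [s < 1]. The slack [1 - s] later pays for replacing the path by a broken line. *)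
Lemma volume_lens_le n w (C : \bar R) :
  (forall s, 0 <= s < 1 -> (volume R n (lens R n s w) <= C)%E) ->
  (volume R n (lens R n 1 w) <= C)%E.
Proof.
move=> lensC.
pose s k : R := 1 - k.+1%:R^-1.
pose f k x : \bar R := (\1_(lens R n (s k) w) x)%:E.
have f0 k x : (0 <= f k x)%E by rewrite lee_fin.
have nds j k : (j <= k)%N -> s j <= s k.
  by move=> jk; rewrite lerD2l lerN2 lef_pV2 ?posrE// ler_nat ltnS.
have ndf y : nondecreasing_seq (f ^~ y).
  move=> j k jk; rewrite /f lee_fin !indicE.
  case: (boolP (y \in lens R n (s j) w)) => [/set_mem[y1 y2]|_]//.
  by rewrite mem_set//; split; [exact: lt_le_trans y1 (nds _ _ jk)|
    exact: lt_le_trans y2 (nds _ _ jk)].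
have limE (u : nat -> \bar R) : nondecreasing_seq u -> limn u = ereal_sup (range u).
  by move=> ndu; apply/cvg_lim => //; exact: ereal_nondecreasing_cvgn.
apply: (@le_trans _ _ (iter_int n (fun x => limn (f ^~ x)) (fun=> 0))).
  apply: le_iter_int => x; first by rewrite lee_fin.
  rewrite limE//; rewrite indicE.
  case: (boolP (x \in lens R n 1 w)) => [/set_mem[x1 x2]|_]; last first.
    by apply: le_ereal_sup_tmp; exists (f 0%N x); [exists 0%N|exact: f0].
  apply: le_ereal_sup_tmp.
  pose d := Num.min (1 - sumsq R n x) (1 - sumsq R n (fun i => x i + w i)).
  have d0 : 0 < d by rewrite lt_min !subr_gt0 x1.
  pose k := Num.truncn d^-1.
  have kd : k.+1%:R^-1 < d.
    by rewrite -[ltRHS]invrK ltf_pV2 ?posrE ?invr_gt0// truncnS_gt.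
  exists (f k x); first by exists k.
  rewrite /f indicE mem_set//; move: kd; rewrite lt_min /lens/= /s.
  by move=> /andP[? ?]; split; rewrite ltrBrDr addrC -ltrBrDr.
rewrite iter_int_limn//; last by move=> k; exact: cylinder_measurable_lens.
rewrite limE; last by move=> j k jk; apply: le_iter_int => // y; exact: ndf.
apply: ge_ereal_sup => _ [k _ <-]; apply: lensC.
rewrite subr_ge0 ltrBlDr ltrDl invr_gt0 ltr0n andbT.
by rewrite invf_le1// ler1n.
Qed.

End MonotoneLimit.

(** * Survival along a path *)

Section Paths.
Context (R : realType).
Implicit Types (x y w : nat -> R).

(** Extension by zero, turning row vectors into the sequences on which iterated integrals act. *)
Definition coords n (v : 'rV[R]_n) : nat -> R :=
  fun i => if insub i is Some k then v ord0 k else 0.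

Lemma coordsE n (v : 'rV[R]_n) (i : 'I_n) : coords n v i = v ord0 i.
Proof. by rewrite /coords valK. Qed.

Lemma euclid_sumsq n (v : 'rV[R]_n) : euclid v = Num.sqrt (sumsq R n (coords n v)).
Proof.
by rewrite /euclid /sumsq; congr Num.sqrt; apply: eq_bigr => i _; rewrite coordsE.
Qed.

Lemma euclid_row n x (v : 'rV[R]_n) : euclid (\row_(i < n) x i + v) =
  Num.sqrt (sumsq R n (fun i => x i + coords n v i)).
Proof.
rewrite /euclid /sumsq; congr Num.sqrt; apply: eq_bigr => i _.
by rewrite !mxE coordsE.
Qed.

Lemma sumsq_ge0 n x : 0 <= sumsq R n x.
Proof. by apply: sumr_ge0 => i _; exact: sqr_ge0. Qed.

Lemma sqrt_ge1 (s : R) : (1 <= Num.sqrt s) = (1 <= s).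
Proof.
have [s0|s0] := leP 0 s; first by rewrite -{1}sqrtr1 ler_sqrt.
rewrite ler0_sqrtr ?ler10; last exact: ltW.
by apply/esym/negbTE; rewrite -ltNge (lt_trans s0).
Qed.

Lemma sumsqZ n (c : R) x : sumsq R n (fun i => c * x i) = c ^+ 2 * sumsq R n x.
Proof. by rewrite /sumsq mulr_sumr; apply: eq_bigr => i _; rewrite exprMn. Qed.

Lemma euclid_le n (v : 'rV[R]_n) (c : R) : 0 <= c ->
  (euclid v <= c) = (sumsq R n (coords n v) <= c ^+ 2).
Proof.
move=> c0; rewrite euclid_sumsq -{1}(ger0_norm c0) -sqrtr_sqr.
by rewrite ler_sqrt// sqr_ge0.
Qed.

(** Jensen's inequality in each coordinate, from nonnegativity of the variance; [N > 0] keeps the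
    inequality strict. *)
Lemma sumsq_avg_lt n N (Y : nat -> nat -> R) (s : R) : (0 < N)%N ->
  (forall j, (j < N)%N -> sumsq R n (Y j) < s) ->
  sumsq R n (fun i => (\sum_(j < N) Y j i) / N%:R) < s.
Proof.
move=> N0 Ys; have N0' : 0 < N%:R :> R by rewrite ltr0n.
have jensen (F : nat -> R) :
    ((\sum_(j < N) F j) / N%:R) ^+ 2 <= (\sum_(j < N) F j ^+ 2) / N%:R.
  set a := _ / N%:R.
  have : 0 <= \sum_(j < N) (F j - a) ^+ 2 by apply: sumr_ge0 => j _; exact: sqr_ge0.
  have -> : \sum_(j < N) (F j - a) ^+ 2 =
      \sum_(j < N) F j ^+ 2 - 2 * a * \sum_(j < N) F j + a ^+ 2 * N%:R.
    rewrite mulr_sumr -sumrN -big_split/=.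
    have -> : a ^+ 2 * N%:R = \sum_(j < N) a ^+ 2.
      by rewrite sumr_const card_ord mulr_natr.
    by rewrite -big_split/=; apply: eq_bigr => j _; ring.
  have -> : \sum_(j < N) F j = a * N%:R by rewrite divfK// gt_eqF.
  rewrite ler_pdivlMr//; lra.
apply: (@le_lt_trans _ _ ((\sum_(j < N) sumsq R n (Y j)) / N%:R)).
  rewrite /sumsq exchange_big/= mulr_suml; apply: ler_sum => i _.
  exact: (jensen (Y ^~ i)).
rewrite ltr_pdivrMr// -[X in _ * X%:R]card_ord mulr_natr -sumr_const.
apply: ltr_sum => [|j _]; last exact: Ys.
by apply/hasP; exists (Ordinal N0) => //; rewrite mem_index_enum.
Qed.

(* [(a + b)^2 <= a^2 / r + b^2 / (1 - r)] *)
Lemma sumsqD_lt1 n (r : R) x y : 0 < r < 1 -> sumsq R n x < r ^+ 2 ->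
  sumsq R n y <= (1 - r) ^+ 2 -> sumsq R n (fun i => x i + y i) < 1.
Proof.
move=> /andP[r0 r1] xr yr; have r1' : 0 < 1 - r by rewrite subr_gt0.
apply: (@le_lt_trans _ _ (sumsq R n x / r + sumsq R n y / (1 - r))).
  rewrite /sumsq !mulr_suml -big_split/=; apply: ler_sum => i _.
  rewrite -subr_ge0.
  have -> : x i ^+ 2 / r + y i ^+ 2 / (1 - r) - (x i + y i) ^+ 2 =
      ((1 - r) * x i - r * y i) ^+ 2 / (r * (1 - r)).
    by field; rewrite !gt_eqF.
  by rewrite divr_ge0 ?sqr_ge0// ltW// mulr_gt0.
have E : r ^+ 2 / r + (1 - r) ^+ 2 / (1 - r) = 1 by field; rewrite !gt_eqF.
by rewrite -[ltRHS]E ltr_leD// ?ltr_pM2r ?ler_pM2r ?invr_gt0.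
Qed.

(** Appending [b] to a subdivision of [[0, a]] gives one of [[0, b]], so [a] plus the chord is at
    most [b]. The case [a = 0] is separate because arc length is prescribed only at positive
    times. *)
Lemma path_lipschitz n (gamma : R -> 'rV[R]_n) (a b : R) : is_path gamma ->
  0 <= a <= b -> euclid (gamma b - gamma a) <= b - a.
Proof.
move=> [_ _ len] /andP[a0 ab].
have [->|ab'] := eqVneq a b.
  by rewrite !subrr euclid_le// expr0n /sumsq big1// => i _; rewrite coordsE mxE expr0n.
have lt_ab : a < b by rewrite lt_neqAle ab'.
have extend k (s : nat -> R) : s 0%N = 0 -> s k = a ->
    (forall i, (i < k)%N -> s i <= s i.+1) ->
    \sum_(i < k) euclid (gamma (s i.+1) - gamma (s i)) +
      euclid (gamma b - gamma a) <= b.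
  move=> s0 sk smon; rewrite -lee_fin -(len b) ?(le_lt_trans a0)//.
  apply: ereal_sup_ubound; exists k.+1, (fun i => if (i <= k)%N then s i else b).
  split=> //.
  - by rewrite ltnn.
  - move=> i; rewrite ltnS; case: (ltngtP i k) => // [ik _|-> _].
      exact: smon.
    by rewrite sk.
  - rewrite big_ord_recr/= leqnn ltnn sk; congr (_ + _)%:E.
    by apply: eq_bigr => i _; rewrite ltn_ord ltnW.
have [a00|a00] := eqVneq a 0.
  have := extend 0%N (fun=> 0) erefl (esym a00); rewrite big_ord0 add0r a00 subr0.
  exact.
have : (curve_length gamma 0 a <= (b - euclid (gamma b - gamma a))%:E)%E.
  apply: ge_ereal_sup => _ [k [s [s0 sk smon ->]]].
  by rewrite lee_fin lerBrDr extend.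
rewrite len ?lt_neqAle ?a0 1?eq_sym ?a00// lee_fin; lra.
Qed.

(* The broken line through the points [gamma (j t / N)] has increments [w j / N]
   with [w j] of norm at most [t]: a mean of points of the lenses of directions
   [w j] stays in the ball along this broken line. *)
Theorem volume_escape n (gamma : R -> 'rV[R]_n) (t : R) w : (0 < n)%N ->
  is_path gamma -> 0 <= t -> sumsq R n w = t ^+ 2 ->
  (volume R n (lens R n 1 w) <= volume R n [set x : nat -> R |
    (euclid (\row_(i < n) x i) <= 1)%R /\
    (t%:E <= escape_time gamma (\row_(i < n) x i))%E])%E.
Proof.
move=> n0 gpath t0 wt; apply: volume_lens_le => s /andP[s0 s1].
have [_ g0 _] := gpath.
(* The mesh points will have squared norm below [s <= r ^+ 2]; the margin [1 - r] is left for the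
   motion between two mesh points. *)
pose r := (1 + s) / 2.
have r01 : 0 < r < 1 by rewrite /r; apply/andP; split; lra.
have sr : s <= r ^+ 2.
  rewrite /r -subr_ge0; have -> : ((1 + s) / 2) ^+ 2 - s = ((1 - s) / 2) ^+ 2 by field.
  exact: sqr_ge0.
have r1 : 0 < 1 - r by rewrite subr_gt0; case/andP: r01.
(* Since [t / (1 - r) < m.+1 <= 2 ^ m], the mesh [t / 2 ^ m] is at most [1 - r]. *)
pose m := Num.truncn (t / (1 - r)).
have tm : t / (2 ^ m)%:R <= 1 - r.
  rewrite ler_pdivrMr ?ltr0n ?expn_gt0// mulrC -ler_pdivrMr//.
  apply: (le_trans (ltW (truncnS_gt _))); rewrite ler_nat -/m.
  exact: ltn_expl.
set N := (2 ^ m)%N in tm; have N0 : (0 < N)%N by rewrite expn_gt0.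
have N0' : 0 < N%:R :> R by rewrite ltr0n.
have N0'' : N%:R != 0 :> R by rewrite gt_eqF.
pose p j := gamma (t * j%:R / N%:R).
(* The factor [N] cancels the division by [N] in the mean, and the Lipschitz bound [t / N] on an
   increment makes the norm of [W j] at most [t]. *)
pose W j : nat -> R := fun i => N%:R * coords n (p j.+1 - p j) i.
have p0 j : 0 <= t * j%:R / N%:R by rewrite divr_ge0// ?mulr_ge0.
apply: (@brunn_minkowski_dyadic R n m (fun j => lens R n s (W j)) _ 1) => //.
- by apply: iter_int_ge0 => x; rewrite lee_fin.
- move=> j x i _ im [xs _].
  rewrite -(@ler_pXn2r _ 2)// ?nnegrE// -normrX ger0_norm ?sqr_ge0// expr1n.
  apply: le_trans (ltW (lt_trans xs s1)).
  rewrite /sumsq (bigD1 (Ordinal im))//= lerDl.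
  by apply: sumr_ge0 => k _; exact: sqr_ge0.
- move=> j jm; apply: volume_lens_mono => //.
  rewrite sumsqZ wt; have : euclid (p j.+1 - p j) <= t / N%:R.
    have -> : t / N%:R = t * j.+1%:R / N%:R - t * j%:R / N%:R.
      by rewrite -natr1; field.
    apply: path_lipschitz => //; rewrite p0/= ler_pM2r ?invr_gt0//.
    by rewrite ler_wpM2l// ler_nat.
  rewrite euclid_le ?divr_ge0// expr_div_n ler_pdivlMr ?exprn_gt0//.
  by rewrite mulrC.
move=> X XA; rewrite -/N; set x := (fun i => _ / _).
have telescope l k : (k <= N)%N ->
    \sum_(j < N) (if (j < k)%N then W j l else 0) = N%:R * coords n (p k) l.
  move=> kN; rewrite -big_mkcond/= -(big_ord_widen _ (W ^~ l) kN).
  elim: k kN => [|k IH] kN.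
    rewrite big_ord0 /p mulr0 mul0r g0 /coords.
    by case: insubP => [? _ _|_]; rewrite ?mxE mulr0.
  rewrite big_ord_recr/= IH 1?ltnW// /W -mulrDr /coords.
  by case: insubP => [? _ _|_]; rewrite ?mxE ?addr0//; congr *%R; ring.
have on_mesh k : (k <= N)%N -> sumsq R n (fun i => x i + coords n (p k) i) < s.
  move=> kN.
  (* [Y j] is one of the two ends of the segment from [X j] to [X j + W j], both in the ball: the
     far end for [j < k]. The mean of the [Y j] is [x] plus the path at mesh point [k]. *)
  pose Y j i := X j i + if (j < k)%N then W j i else 0.
  have -> : (fun i => x i + coords n (p k) i) =
      (fun i => (\sum_(j < N) Y j i) / N%:R).
    apply/funext => i; rewrite /Y big_split/= telescope// mulrDl.
    by rewrite mulrAC divff// mul1r.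
  apply: sumsq_avg_lt => // j jN; have [X1 X2] := XA _ jN.
  rewrite /Y; case: (j < k)%N => //.
  by under eq_fun do rewrite addr0.
have x1 : sumsq R n x < s.
  have := on_mesh 0%N isT; rewrite /p mulr0 mul0r g0; congr (_ < _).
  by apply: eq_bigr => i _; rewrite coordsE mxE addr0.
split.
  rewrite -[X in euclid X]addr0 euclid_row -sqrtr1 ler_sqrt//.
  apply: le_trans (ltW (lt_trans x1 s1)).
  by apply: ler_sum => i _; rewrite coordsE mxE addr0.
apply: le_ereal_inf_tmp => _ [tau [tau0 tau1] <-].
rewrite lee_fin leNgt; apply/negP => taut.
have tpos : 0 < t by exact: le_lt_trans taut.
move: tau1; rewrite euclid_row sqrt_ge1 leNgt => /negP; apply.
(* The last mesh point not after [tau]; the path moves by at most [1 - r] from there to [tau]. *)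
pose k := Num.truncn (tau * N%:R / t).
have tauN : 0 <= tau * N%:R / t by rewrite divr_ge0 ?mulr_ge0// ltW.
have /andP[k1 k2] := truncn_itv tauN; rewrite -/k in k1 k2.
have kN : (k < N)%N.
  rewrite -(ltr_nat R); apply: le_lt_trans k1 _.
  by rewrite ltr_pdivrMr// mulrC ltr_pM2l.
have ks : t * k%:R / N%:R <= tau.
  by rewrite ler_pdivrMr// mulrC -ler_pdivlMr.
have ks2 : tau - t * k%:R / N%:R <= 1 - r.
  apply: le_trans tm; rewrite lerBlDr -mulrDl ler_pdivlMr//.
  move: k2; rewrite ltr_pdivrMr// -natr1 => /ltW /le_trans; apply; lra.
have -> : (fun i => x i + coords n (gamma tau) i) =
    (fun i => (x i + coords n (p k) i) + coords n (gamma tau - p k) i).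
  apply/funext => i; rewrite -addrA; congr +%R.
  by rewrite /coords; case: insubP => [? _ _|_]; rewrite ?mxE ?addr0//; ring.
apply: (sumsqD_lt1 _ _ _ _ r01).
  by apply: lt_le_trans sr; apply: on_mesh; exact: ltnW.
rewrite -euclid_le; last exact: ltW.
apply: le_trans ks2.
by apply: path_lipschitz => //; rewrite p0.
Qed.

End Paths.

(** * Level sums of escape times and the comparison *)

Section EscapeTime.
Context (R : realType).

Lemma iter_int_indic_sum m (A : nat -> set (nat -> R)) (c : R) K x : 0 <= c ->
  (forall k, cylinder_measurable R (fun y => (\1_(A k) y)%:E)) ->
  (iter_int m (fun y => (c * \sum_(k < K) \1_(A k) y)%:E) x =
   c%:E * \sum_(k < K) iter_int m (fun y => (\1_(A k) y)%:E) x)%E.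
Proof.
move=> c0 mA; have ind0 k y : (0 <= (\1_(A k) y : R)%:E)%E by rewrite lee_fin.
elim: m x => [|m IH] x; first by rewrite /= EFinM sumEFin.
have mline k := measurable_line _ (iter_int m (fun y => (\1_(A k) y)%:E)) x m
  (cylinder_measurable_iter_int _ m _ (ind0 k) (mA k)).
have pos k t : (0 <= iter_int m (fun y => (\1_(A k) y)%:E) (update R x m t))%E.
  exact: iter_int_ge0.
transitivity (\int[@lebesgue_measure R]_t (c%:E *
    \sum_(k < K) iter_int m (fun y => (\1_(A k) y)%:E) (update R x m t)))%E.
  by apply: eq_integral => t _; exact: IH.
rewrite ge0_integralZl_EFin//; last 2 first.
- by move=> t _; apply: sume_ge0 => k _.
- by apply: emeasurable_sum => k.
by rewrite ge0_integral_sum.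
Qed.

(** Superadditivity gives this direction for arbitrary sets, as required for the survival sets of
    [gamma]. *)
Lemma iter_int_indic_sum_ge m (A : nat -> set (nat -> R)) (c : R) K x : 0 <= c ->
  (c%:E * \sum_(k < K) iter_int m (fun y => (\1_(A k) y)%:E) x <=
   iter_int m (fun y => (c * \sum_(k < K) \1_(A k) y)%:E) x)%E.
Proof.
move=> c0; have ind0 k y : (0 <= (\1_(A k) y : R)%:E)%E by rewrite lee_fin.
apply: (@le_trans _ _ (c%:E *
    iter_int m (fun y => (\sum_(k < K) \1_(A k) y)%:E) x)%E); last first.
  by apply: iter_intZ => // y; rewrite lee_fin sumr_ge0.
rewrite lee_wpmul2l ?lee_fin//; elim: K => [|K IH].
  rewrite big_ord0; apply: iter_int_ge0 => y; rewrite big_ord0.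
  exact: lexx.
rewrite big_ord_recr/=.
under [leRHS]eq_iter_int do rewrite big_ord_recr/= EFinD.
apply: le_trans (iter_intD _ _ _ _ _ _ _) => //; first exact: leeD.
by move=> y; rewrite lee_fin sumr_ge0.
Qed.

Lemma escape_time_ge0 n (gamma : R -> 'rV[R]_n) v : (0 <= escape_time gamma v)%E.
Proof. by apply: le_ereal_inf_tmp => _ [t [t0 _] <-]; rewrite lee_fin. Qed.

(** From [0 <= |2v + 2u|^2 = 2|v|^2 + 2|v + 2u|^2 - 4|u|^2], time 2 is already outside the open
    ball. This bounds the number of levels in the sum for the line. *)
Lemma line_escape_time_le2 n (u v : 'rV[R]_n) : euclid u = 1 -> euclid v <= 1 ->
  (escape_time (fun s : R => s *: u) v <= 2%:E)%E.
Proof.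
move=> u1 v1; apply: ereal_inf_lbound; exists 2 => //; split => //.
have u2 : \sum_(i < n) u ord0 i ^+ 2 = 1.
  move: u1 => /(congr1 (fun c => c ^+ 2)); rewrite /euclid sqr_sqrtr ?expr1n//.
  by apply: sumr_ge0 => i _; exact: sqr_ge0.
have v2 : \sum_(i < n) v ord0 i ^+ 2 <= 1.
  move: v1; rewrite /euclid -{1}sqrtr1 ler_sqrt//.
rewrite /euclid sqrt_ge1 -subr_ge0.
have : 0 <= \sum_(i < n) (2 * v ord0 i + 2 * u ord0 i) ^+ 2.
  by apply: sumr_ge0 => i _; exact: sqr_ge0.
have -> : \sum_(i < n) (2 * v ord0 i + 2 * u ord0 i) ^+ 2 =
    2 * \sum_(i < n) v ord0 i ^+ 2 + 2 * \sum_(i < n) (v + 2 *: u) ord0 i ^+ 2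
    - 4 * \sum_(i < n) u ord0 i ^+ 2.
  rewrite !mulr_sumr -sumrN -!big_split/=; apply: eq_bigr => i _.
  by rewrite !mxE; ring.
by rewrite u2; lra.
Qed.

End EscapeTime.

Lemma sumsq_scaled_unit (R : realType) n (u : 'rV[R]_n) (t : R) : euclid u = 1 ->
  sumsq R n (coords R n (t *: u)) = t ^+ 2.
Proof.
move=> u1; have -> : coords R n (t *: u) = fun i => t * coords R n u i.
  by apply/funext => i; rewrite /coords; case: insubP => *; rewrite ?mxE ?mulr0.
rewrite sumsqZ; move: u1 => /(congr1 (fun c => c ^+ 2)); rewrite euclid_sumsq.
by rewrite sqr_sqrtr ?sumsq_ge0// expr1n => ->; rewrite mulr1.
Qed.

(** An upper level sum: if the time exceeds level [k], then [x] and its translate by that level are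
    both in the open ball. The odd number of terms leaves [(N.+1).*2] once the term [k = 0] is
    removed. *)
Lemma line_escape_level (R : realType) n (u : 'rV[R]_n) (N : nat) (x : nat -> R) :
  euclid u = 1 ->
  ((if (euclid (\row_(i < n) x i) <= 1)%R then
     escape_time (fun s : R => s *: u) (\row_(i < n) x i) else 0) <=
   (N.+1%:R^-1 * \sum_(k < (N.+1).*2.+1)
     \1_(lens R n 1 (coords R n ((N.+1%:R^-1 * k%:R) *: u))) x)%:E)%E.
Proof.
move=> u1; have d0 : 0 <= N.+1%:R^-1 :> R by rewrite invr_ge0.
case: ifPn => [x1|_]; last by rewrite lee_fin mulr_ge0// sumr_ge0.
have T0 := escape_time_ge0 R n (fun s => s *: u) (\row_(i < n) x i).
have T2 := line_escape_time_le2 R n u _ u1 x1.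
have out s : 0 <= s -> (s%:E < escape_time (fun s : R => s *: u) (\row_(i < n) x i))%E ->
    sumsq R n (fun i => x i + coords R n (s *: u) i) < 1.
  move=> s0 sT; rewrite ltNge -sqrt_ge1 -euclid_row; apply: contraL sT => s1.
  by rewrite -leNgt; apply: ereal_inf_lbound; exists s.
move: T0 T2 out; case: (escape_time _ _) => [v|//|//].
rewrite !lee_fin => v0 v2 out.
apply: (@le_trans _ _ (N.+1%:R^-1 *
    \sum_(k < (N.+1).*2.+1) (N.+1%:R^-1 * k%:R < v)%R%:R)).
  apply: le_level_sum => //; apply: (le_trans v2).
  by rewrite mulrC ler_pdivlMr// -natrM ler_nat mul2n.
rewrite ler_wpM2l//; apply: ler_sum => k _.
case: ltP => // kv; rewrite indicE mem_set//.
have x0 : sumsq R n x < 1.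
  have := out 0 (lexx _); rewrite lte_fin (le_lt_trans _ kv) ?mulr_ge0// => /(_ isT).
  congr (_ < _); apply: eq_bigr => i _.
  by rewrite coordsE mxE mul0r addr0.
by split => //; apply: out; rewrite ?mulr_ge0// lte_fin.
Qed.

(** A lower level sum, hence levels [k.+1] instead of [k]. *)
Lemma escape_level (R : realType) n (gamma : R -> 'rV[R]_n) (N K : nat) (x : nat -> R) :
  ((N.+1%:R^-1 * \sum_(k < K) \1_[set x : nat -> R |
      (euclid (\row_(i < n) x i) <= 1)%R /\
      ((N.+1%:R^-1 * k.+1%:R)%:E <= escape_time gamma (\row_(i < n) x i))%E] x)%:E <=
   if (euclid (\row_(i < n) x i) <= 1)%R then
     escape_time gamma (\row_(i < n) x i) else 0)%E.
Proof.
have d0 : 0 <= N.+1%:R^-1 :> R by rewrite invr_ge0.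
case: ifPn => [x1|x1]; last first.
  rewrite big1 ?mulr0// => k _; rewrite indicE memNset// => -[x1' _].
  by rewrite x1' in x1.
have T0 := escape_time_ge0 R n gamma (\row_(i < n) x i).
set T := escape_time _ _ in T0 *.
have -> : \sum_(k < K) \1_[set x : nat -> R |
      (euclid (\row_(i < n) x i) <= 1)%R /\
      ((N.+1%:R^-1 * k.+1%:R)%:E <= escape_time gamma (\row_(i < n) x i))%E] x =
    \sum_(k < K) ((N.+1%:R^-1 * k.+1%:R)%:E <= T)%E%:R :> R.
  apply: eq_bigr => k _; rewrite indicE; congr ((nat_of_bool _)%:R).
  by apply/idP/idP => [/set_mem[]//|kT]; apply/mem_set; split.
move: T0; case: T => [v|_|//]; last by rewrite leey.
rewrite !lee_fin => v0.
by apply: (level_sum_le _ _ _ _ (fun k => ((N.+1%:R^-1 * k.+1%:R)%:E <= v%:E)%E)).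
Qed.

Lemma escape_integrand_ge0 (R : realType) n (gamma : R -> 'rV[R]_n) (x : nat -> R) :
  (0 <= if (euclid (\row_(i < n) x i) <= 1)%R then
    escape_time gamma (\row_(i < n) x i) else 0)%E.
Proof. by case: ifP => // _; exact: escape_time_ge0. Qed.

Theorem theorem4 (R : realType) (n : nat) (hn : (1 <= n)%N)
    (gamma : R -> 'rV[R]_n) (hgamma : is_path gamma)
    (u : 'rV[R]_n) (hu : euclid u = 1) :
  (expected_escape (fun s : R => s *: u) <= expected_escape gamma)%E.
Proof.
apply: lee_wpmul2r.
  rewrite lee_fin invr_ge0; apply: fine_ge0; apply: iter_int_ge0 => x.
  by rewrite /closed_ball_ind; case: ifP.
pose L (t : R) := lens R n 1 (coords R n (t *: u)).
pose V t := volume R n (L t).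
have V0 t : (0 <= V t)%E by apply: iter_int_ge0 => x; rewrite lee_fin.
have VC t : (V t <= (2 ^+ n)%:E)%E.
  have := @iter_int_bounded R n (fun x => (\1_(L t) x)%:E) 1 1 (fun=> 0) ler01 ler01.
  rewrite mul1r mulr1; apply.
    by move=> x; rewrite !lee_fin indicE; case: (_ \in _); rewrite ?ler01 ?lexx.
  move=> x i im x1; rewrite indicE memNset// => -[xs _].
  move: x1; rewrite ltNge => /negP; apply.
  rewrite -(@ler_pXn2r _ 2)// ?nnegrE// -normrX ger0_norm ?sqr_ge0// expr1n.
  apply: le_trans (ltW xs); rewrite /sumsq (bigD1 (Ordinal im))//= lerDl.
  by apply: sumr_ge0 => k _; exact: sqr_ge0.
apply/lee_addgt0Pr => e e0.
(* Chosen so that one term of the level sum, at most [2 ^+ n / N.+1] by the volume of the enclosing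
   cube, is at most [e]. *)
pose N := Num.truncn (2 ^+ n / e).
have d0 : 0 <= N.+1%:R^-1 :> R by rewrite invr_ge0.
have small : N.+1%:R^-1 * 2 ^+ n <= e.
  rewrite mulrC ler_pdivrMr// -ler_pdivrMl// mulrC.
  exact: ltW (truncnS_gt _).
pose tk (k : nat) : R := N.+1%:R^-1 * k%:R.
apply: (@le_trans _ _ (N.+1%:R^-1%:E * \sum_(k < (N.+1).*2.+1) V (tk k))%E).
  rewrite -(iter_int_indic_sum _ _ (fun k => L (tk k)))//; last first.
    by move=> k; exact: cylinder_measurable_lens.
  apply: le_iter_int => x; first exact: escape_integrand_ge0.
  exact: line_escape_level.
(* The term [k = 0] is absorbed by [e]; the others are at levels [k.+1], matching the lower sum for
   [gamma] term by term. *)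
rewrite big_ord_recl ge0_muleDr//; last exact: sume_ge0.
rewrite addeC; apply: leeD; last first.
  apply: (@le_trans _ _ (N.+1%:R^-1%:E * (2 ^+ n)%:E)%E).
    by rewrite lee_wpmul2l// lee_fin.
  by rewrite -EFinM lee_fin.
apply: (@le_trans _ _ (N.+1%:R^-1%:E * \sum_(k < (N.+1).*2)
    volume R n [set x : nat -> R | (euclid (\row_(i < n) x i) <= 1)%R /\
      ((N.+1%:R^-1 * k.+1%:R)%:E <= escape_time gamma (\row_(i < n) x i))%E])%E).
  rewrite lee_wpmul2l ?lee_fin//; apply: lee_sum => k _.
  by apply: volume_escape => //; exact: sumsq_scaled_unit.
apply: le_trans (iter_int_indic_sum_ge R n (fun k => [set x : nat -> R |
  (euclid (\row_(i < n) x i) <= 1)%R /\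
  ((N.+1%:R^-1 * k.+1%:R)%:E <= escape_time gamma (\row_(i < n) x i))%E])
  _ _ _ d0) _.
apply: le_iter_int => x; last exact: escape_level.
by rewrite lee_fin mulr_ge0// sumr_ge0.
Qed.
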